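(* Let $u$ be a smooth axially symmetric vector field which, together with a smooth pressure $p$ on $\mathbb{R}^2\times S^1$, solves $$ \begin{cases} (u\cdot\nabla)u+\nabla p-\Delta u=0 & \text{in } \mathbb{R}^2\times S^1=\mathbb{R}^2\times[-\pi,\pi],\\ \nabla\cdot u=0,\\ u(x_1,x_2,z)=u(x_1,x_2,z+2\pi),\\ \lim_{|x|\to\infty}u=0, \end{cases} $$ with finite Dirichlet integral $$\int_{-\pi}^{\pi}\int_{\mathbb{R}^2}|\nabla u(x)|^2\,dx<+\infty .$$ Then $u=0$.
   Context: Here $S^1=\mathbb{R}/2\pi\mathbb{Z}$, identified with $[-\pi,\pi]$ with endpoints glued, so functions on $\mathbb{R}^2\times S^1$ are functions of $(x_1,x_2,z)$ that are $2\pi$-periodic in $z$; $|x|\to\infty$ on this domain means $|(x_1,x_2)|\to\infty$ (uniformly in $z$). Use cylindrical coordinates $r=\sqrt{x_1^2+x_2^2}$, $\theta=\tan^{-1}(x_2/x_1)$, $z$, and $e_r=(x_1/r,x_2/r,0)$, $e_\theta=(-x_2/r,x_1/r,0)$, $e_z=(0,0,1)$. An axially symmetric solution is one of the form $u(x)=u^r(r,z)e_r+u^\theta(r,z)e_\theta+u^z(r,z)e_z$, i.e. the components $u^r,u^\theta,u^z$ (and the pressure $p$) do not depend on $\theta$, and they satisfy $$ \begin{cases} (u^r\partial_r+u^z\partial_z)u^r-\frac{(u^\theta)^2}{r}+\partial_r p=(\partial_r^2+\frac1r\partial_r+\partial_z^2-\frac1{r^2})u^r,\\ (u^r\partial_r+u^z\partial_z)u^\theta+\frac{u^ru^\theta}{r}=(\partial_r^2+\frac1r\partial_r+\partial_z^2-\frac1{r^2})u^\theta,\\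 (u^r\partial_r+u^z\partial_z)u^z+\partial_z p=(\partial_r^2+\frac1r\partial_r+\partial_z^2)u^z,\\ \partial_ru^r+\frac{u^r}{r}+\partial_zu^z=0. \end{cases} $$ *)

(* Defs.v *)
From HB Require Import structures.
From mathcomp Require Import all_boot all_order all_algebra.
From mathcomp Require Import all_classical all_reals all_analysis.

Set Implicit Arguments.
Unset Strict Implicit.
Unset Printing Implicit Defensive.

Import Order.TTheory GRing.Theory Num.Theory.
Import numFieldNormedType.Exports.

Local Open Scope classical_set_scope.
Local Open Scope ring_scope.

Section SmoothMaps.
Variables (R : realType) (n : nat) (V : normedModType R).
Implicit Types f : 'rV[R]_n -> V.

Definition partial (i : 'I_n) f : 'rV[R]_n -> V :=
  fun x => 'D_(delta_mx 0 i) f x.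

Definition iter_partial (s : seq 'I_n) f : 'rV[R]_n -> V := foldr partial f s.

(* C^oo: iterated partial derivatives of every order exist (recall that 'D is
   a total operator, whence the explicit derivability) and are continuous. *)
Definition smooth f : Prop := forall s : seq 'I_n,
  continuous (iter_partial s f) /\
  forall (i : 'I_n) (x : 'rV[R]_n), derivable (iter_partial s f) x (delta_mx 0 i).

Definition laplacian f : 'rV[R]_n -> V :=
  fun x => \sum_(i < n) partial i (partial i f) x.

End SmoothMaps.

Section VectorFields.
Variables (R : realType) (n : nat).
Implicit Types (u v : 'rV[R]_n -> 'rV[R]_n) (p : 'rV[R]_n -> R).

Definition gradient p : 'rV[R]_n -> 'rV[R]_n :=
  fun x => \row_(i < n) partial i p x.

Definition divergence u : 'rV[R]_n -> R :=
  fun x => \sum_(i < n) partial i u x 0 i.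

(* (u . nabla) v *)
Definition advection u v : 'rV[R]_n -> 'rV[R]_n :=
  fun x => \sum_(i < n) u x 0 i *: partial i v x.

(* |nabla u|^2, in the Euclidean (Frobenius) norm *)
Definition grad_sqnorm u : 'rV[R]_n -> R :=
  fun x => \sum_(i < n) \sum_(j < n) (partial i u x 0 j) ^+ 2.

End VectorFields.

(* Functions on R^2 x S^1 are functions of x = (x1, x2, z) in R^3 that are
   2pi-periodic in z. *)
Section Cylinder.
Variable R : realType.
Local Notation R3 := 'rV[R]_3.

Definition vec3 (a b c : R) : R3 := \row_(j < 3) [:: a; b; c]`_j.

Definition x1 (x : R3) : R := x 0 0.
Definition x2 (x : R3) : R := x 0 1.
Definition xz (x : R3) : R := x 0 2.

Definition cyl_rad (x : R3) : R := Num.sqrt (x1 x ^+ 2 + x2 x ^+ 2).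

Definition e_r (x : R3) : R3 := vec3 (x1 x / cyl_rad x) (x2 x / cyl_rad x) 0.
Definition e_theta (x : R3) : R3 := vec3 (- x2 x / cyl_rad x) (x1 x / cyl_rad x) 0.
Definition e_z : R3 := vec3 0 0 1.

Definition z_periodic (T : Type) (f : R3 -> T) : Prop :=
  forall x, f (x + vec3 0 0 (2 * pi)) = f x.

(* The axis r = 0, where e_r and e_theta are undefined, is left out. *)
Definition axisymmetric_field (u : R3 -> R3) : Prop :=
  exists ur utheta uz : R -> R -> R, forall x, 0 < cyl_rad x ->
    u x = ur (cyl_rad x) (xz x) *: e_r x + utheta (cyl_rad x) (xz x) *: e_theta x
          + uz (cyl_rad x) (xz x) *: e_z.

Definition axisymmetric_function (p : R3 -> R) : Prop :=
  exists P : R -> R -> R, forall x, 0 < cyl_rad x -> p x = P (cyl_rad x) (xz x).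

(* neighbourhoods of infinity in R^2 x S^1: |(x1, x2)| -> oo uniformly in z *)
Definition infty_nbhs : set_system R3 :=
  filter_from setT (fun M : R => [set x | M < cyl_rad x]).

Definition navier_stokes (u : R3 -> R3) (p : R3 -> R) : Prop :=
  (forall x, advection u u x + gradient p x - laplacian u x = 0) /\
  (forall x, divergence u x = 0).

Local Open Scope ereal_scope.

Definition dirichlet_integral (u : R3 -> R3) : \bar R :=
  \int[@lebesgue_measure R]_(z in `[(- pi)%R, pi])
    \int[@lebesgue_measure R \x @lebesgue_measure R]_y
      (grad_sqnorm u (vec3 y.1 y.2 z))%:E.

End Cylinder.

(* Main.v *)
Require Import Defs.
From HB Require Import structures.
From mathcomp Require Import all_boot all_order all_algebra.
From mathcomp Require Import all_classical all_reals all_analysis.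
From mathcomp Require Import measurable_realfun.
From mathcomp Require Import ring lra.

Set Implicit Arguments.
Unset Strict Implicit.
Unset Printing Implicit Defensive.

Import Order.TTheory GRing.Theory Num.Theory.
Import numFieldNormedType.Exports.

Local Open Scope classical_set_scope.
Local Open Scope ring_scope.

(** Everything happens on one half-plane, the set of the points
    X(s, z) = (s, s t, z) with s > 0, whose slope t is fixed.  There, write
    c = 1 + t^2, v = u_2, w = x_0 u_0 + x_1 u_1 (that is, r times the radial
    velocity), q = |u|^2 / 2, E = |grad u|^2, and let e(s) be the integral of
    E(X(s, z)) over -pi <= z <= pi.  Coordinates (s, z) replace (r, z), which
    keeps every function polynomial in the Cartesian data; axial symmetry enters
    only through the vanishing of the angular derivative
    x_0 d_1 - x_1 d_0 on p, q and v, and through its values -u_1 and u_0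
    on u_0 and u_1.

    Monotone flux.  From Laplacian(q) = |grad u|^2 + u . grad (q + p)
    ([bernoulli]) follows, on the half-plane,
      d_s (s q_s - w (q + p)) = c s (E - d_z (q_z - v (q + p))).
    Integrated over a period in z, the energy flux
      K(s) = int (s q_s - w (q + p)) dz
    satisfies K' = c s e >= 0 and K(0) = 0.  If K vanishes identically, then so
    does e, and grad u = 0 on the half-plane.

    Removing the pressure.  Nothing is known about the size of p, so the term
    -int w p has to be rewritten.  As div u = 0 reads w_s = - c s v_z, there is a
    stream function G with G_z = w and G_s = - c s (v - v(s, -pi)); by
    periodicity it vanishes at both ends z = -pi and z = pi ([stream]).  So
    -int w p = int G p_z, where the axial momentum equation gives p_z.  The
    outcome ([flux_identity]) expresses c s K as
      c s^2 Q' + M' + int rho,   Q = int q,   M = int G s v_s,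
    without pressure.  Moreover G vanishes at both ends, hence w = G_z vanishes
    somewhere in between, so that w^2 and G^2 are at most a constant times
    s^2 e; this makes M and all of rho but one linear term quadratic in
    quantities that e controls.

    No logarithmic growth.  Suppose K(s_0) = k > 0.  Then K >= k beyond s_0,
    and for Y = Q + M / (c s^2) the identity gives
      k / (2 s) <= Y' + C s e,
    so that Y + C K - (k / 2) ln s is nondecreasing for some C.  When the integral
    of s e(s) converges, K is bounded; since Y <= C (1 + e), the term ln s forces
    e >= 1 far away, and the integral diverges ([no_log_growth]).  Hence K = 0.

    Choosing the half-plane.  In coordinates x_1 = t x_0 the plane measure is
    |x_0| dx_0 dt, so finiteness of the Dirichlet integral makes
    the integral of s e(s) finite for at least one t in [0, 1]
    ([finite_energy_ray]).  On that half-plane u is constant along each ray, and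
    its limit is 0; as |u| depends on (r, z) alone, u = 0 off the axis, hence
    everywhere ([liouville]). *)

(** * Integrals of continuous functions over a segment *)

Section ContinuityRules.
Variables (R : realType) (T : topologicalType).
Implicit Types f g : T -> R.

Lemma cont_cst (k : R) : continuous (fun _ : T => k).
Proof. by move=> x; exact: cvg_cst. Qed.

Lemma cont_add f g : continuous f -> continuous g ->
  continuous (fun x => f x + g x).
Proof. by move=> cf cg x; apply: cvgD; [exact: cf|exact: cg]. Qed.

Lemma cont_opp f : continuous f -> continuous (fun x => - f x).
Proof. by move=> cf x; apply: cvgN; exact: cf. Qed.

Lemma cont_mul f g : continuous f -> continuous g ->
  continuous (fun x => f x * g x).
Proof. by move=> cf cg x; apply: cvgM; [exact: cf|exact: cg]. Qed.

Lemma cont_exp f n : continuous f -> continuous (fun x => f x ^+ n).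
Proof.
move=> cf; elim: n => [|n IH]; first exact: cont_cst.
by under eq_fun do rewrite exprS; exact: cont_mul.
Qed.

Lemma cont_norm f : continuous f -> continuous (fun x => `|f x|).
Proof. by move=> cf x; apply: cvg_norm; exact: cf. Qed.

Lemma cont_sum (I : Type) (r : seq I) (F : I -> T -> R) :
  (forall i, continuous (F i)) -> continuous (fun x => \sum_(i <- r) F i x).
Proof.
move=> cF; elim: r => [|i r IH].
  by under eq_fun do rewrite big_nil; exact: cont_cst.
by under eq_fun do rewrite big_cons; exact: cont_add.
Qed.

End ContinuityRules.

Section JointContinuity.
Variable R : realType.

Lemma cont_comp2 (T : topologicalType) (f : R -> R -> R) (g h : T -> R) :
  continuous (fun x : R * R => f x.1 x.2) -> continuous g -> continuous h ->
  continuous (fun x => f (g x) (h x)).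
Proof.
move=> cf cg ch z.
apply: (@continuous_comp _ _ _ (fun z => (g z, h z)) (fun x : R * R => f x.1 x.2)).
  by apply: (@cvg_pair _ _ _ (nbhs z) (nbhs (g z)) (nbhs (h z))); [exact: cg|exact: ch].
exact: cf.
Qed.

Lemma cont_id : continuous (fun x : R => x).
Proof. by move=> x; exact: cvg_id. Qed.

Lemma cont_fst : continuous (fun x : R * R => x.1).
Proof. by move=> x; exact: cvg_fst. Qed.

Lemma cont_snd : continuous (fun x : R * R => x.2).
Proof. by move=> x; exact: cvg_snd. Qed.

End JointContinuity.

Ltac cont := lazymatch goal with
  | |- continuous (fun _ => ?k) => exact: cont_cst
  | |- continuous (fun x => x) => exact: cont_id
  | |- continuous (fun x => x.1) => exact: cont_fst
  | |- continuous (fun x => x.2) => exact: cont_snd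
  | |- continuous (fun x => @?f x + @?g x) => apply: (@cont_add _ _ f g); cont
  | |- continuous (fun x => - @?f x) => apply: (@cont_opp _ _ f); cont
  | |- continuous (fun x => @?f x * @?g x) => apply: (@cont_mul _ _ f g); cont
  | |- continuous (fun x => @?f x ^+ ?n) => apply: (@cont_exp _ _ f n); cont
  | |- continuous (fun x => `|@?f x|) => apply: (@cont_norm _ _ f); cont
  | |- continuous (fun x => ?f (@?g x) (@?h x)) =>
      first [assumption | apply: (@cont_comp2 _ _ f g h); [assumption|cont|cont]]
  | |- continuous (?f ?s) => first [assumption
      | apply: (@cont_comp2 _ _ f (fun _ => s) (fun z => z)); [assumption|cont|cont]]
  | |- _ => assumption
  end.

Section SegmentIntegral.
Variable R : realType.
Implicit Types (a b x y : R) (f g F : R -> R).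
Notation mu := (@lebesgue_measure R).

Definition rint a b f : R := \int[mu]_(x in `[a, b]) f x.

Lemma continuous_integrable a b f :
  continuous f -> mu.-integrable `[a, b] (EFin \o f).
Proof.
move=> cf; apply: continuous_compact_integrable; first exact: segment_compact.
exact: continuous_subspaceT.
Qed.

Lemma rintD a b f g : continuous f -> continuous g ->
  rint a b (fun x => f x + g x) = rint a b f + rint a b g.
Proof. by move=> cf cg; rewrite /rint RintegralD//; exact: continuous_integrable. Qed.

Lemma rintZ a b k f : continuous f ->
  rint a b (fun x => k * f x) = k * rint a b f.
Proof. by move=> cf; rewrite /rint RintegralZl//; exact: continuous_integrable. Qed.

Lemma eq_rint a b f g : f =1 g -> rint a b f = rint a b g.
Proof. by move=> fg; apply: eq_Rintegral => x _. Qed.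

Lemma rint_cst a b k : a <= b -> rint a b (fun=> k) = (b - a) * k.
Proof.
move=> ab; rewrite /rint Rintegral_cst// mulrC; congr (_ * _).
have /= -> := lebesgue_measure_itv `[a, b]; rewrite lte_fin.
move: ab; rewrite le_eqVlt => /predU1P[->|->]; first by rewrite ltxx subrr.
by rewrite -EFinD.
Qed.

Lemma le_rint a b f g : continuous f -> continuous g ->
  (forall x, a <= x <= b -> f x <= g x) -> rint a b f <= rint a b g.
Proof.
move=> cf cg fg; apply: le_Rintegral => //; try exact: continuous_integrable.
Qed.

Lemma rint_ge0 a b f : (forall x, 0 <= f x) -> 0 <= rint a b f.
Proof. by move=> f0; apply: Rintegral_ge0. Qed.

Lemma derive_continuous F f : (forall x, is_derive x 1 F (f x)) -> continuous F.
Proof.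
move=> dF x; apply/differentiable_continuous/derivable1_diffP.
by have [] := dF x.
Qed.

Lemma rint_FTC a b F f : a <= b -> continuous f ->
  (forall x, is_derive x 1 F (f x)) -> rint a b f = F b - F a.
Proof.
rewrite le_eqVlt => /predU1P[->|ab] cf dF.
  by rewrite /rint set_itv1 Rintegral_set1 subrr.
have cF := derive_continuous dF.
rewrite /rint /Rintegral (@continuous_FTC2 _ _ F)//.
- exact: continuous_subspaceT.
- split; [by move=> x _; have [] := dF x| |].
  + by apply: cvg_at_right_filter; exact: cF.
  + by apply: cvg_at_left_filter; exact: cF.
- by move=> x _; rewrite derive1E; have [_] := dF x.
Qed.

Lemma rint_derive_endpoints a b F f : a <= b -> continuous f ->
  (forall x, is_derive x 1 F (f x)) -> F a = F b -> rint a b f = 0.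
Proof. by move=> ab cf dF FE; rewrite (rint_FTC ab cf dF) FE subrr. Qed.

Lemma rint_sub a b x y f : continuous f -> (forall z, 0 <= f z) ->
  a <= x -> y <= b -> rint x y f <= rint a b f.
Proof.
move=> cf f0 ax yb; rewrite /rint /Rintegral fine_le//.
- by apply: integrable_fin_num => //; exact: continuous_integrable.
- by apply: integrable_fin_num => //; exact: continuous_integrable.
apply: ge0_subset_integral => //.
- apply/measurable_EFinP.
  by apply: measurable_funTS; exact: continuous_measurable_fun.
- by move=> z _; rewrite lee_fin.
- move=> z /=; rewrite !in_itv/= => /andP[xz zy]; apply/andP; split; lra.
Qed.

(** Expand the nonnegative integral of the square of (b - a) f - int f: the
    Cauchy-Schwarz inequality against the constant function 1. *)
Lemma sqr_rint_le a b f : a <= b -> continuous f ->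
  (rint a b f) ^+ 2 <= (b - a) * rint a b (fun x => f x ^+ 2).
Proof.
move=> ab cf; set m := rint a b f.
have cf2 : continuous (fun x => f x ^+ 2) by cont.
have : 0 <= rint a b (fun x => ((b - a) * f x - m) ^+ 2).
  by apply: rint_ge0 => x; exact: sqr_ge0.
rewrite (@eq_rint _ _ _ (fun x => ((b - a)^+2 * f x ^+ 2 + (- 2 * (b - a) * m) * f x) + m^+2)); last first.
  by move=> x; ring.
rewrite rintD; [|by cont..].
rewrite rintD; [|by cont..].
rewrite rint_cst// rintZ; last by cont.
rewrite rintZ// -/m.
move: ab; rewrite le_eqVlt => /predU1P[abE|ab].
  by rewrite /m /rint abE set_itv1 !Rintegral_set1 expr0n/= subrr !mul0r.
move=> H.
rewrite -subr_ge0 -(pmulr_rge0 _ (_ : 0 < b - a)) ?subr_gt0//.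
move: H; set I2 := rint _ _ _ => H.
by have -> : (b - a) * ((b - a) * I2 - m ^+ 2) = (b - a) ^+ 2 * I2 + -2 * (b - a) * m * m + (b - a) * m ^+ 2 by ring.
Qed.

(** The increment is the integral of the derivative.  This is the one-dimensional
    Poincare inequality: a function that vanishes somewhere is controlled by
    its derivative in mean square. *)
Lemma sqr_osc_le a b F f x y : continuous f ->
  (forall x, is_derive x 1 F (f x)) -> a <= x <= b -> a <= y <= b ->
  (F x - F y) ^+ 2 <= (b - a) * rint a b (fun x => f x ^+ 2).
Proof.
move=> cf dF.
have cf2 : continuous (fun x => f x ^+ 2) by cont.
wlog xy : x y / y <= x.
  move=> H xab yab; have [/H|/ltW xy] := leP y x; first exact.
  by rewrite -sqrrN opprB H.
move=> /andP[ax xb] /andP[ay yb].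
rewrite -(rint_FTC xy cf dF) (le_trans (sqr_rint_le xy cf))//.
rewrite ler_pM ?subr_ge0//; [by apply: rint_ge0 => z; exact: sqr_ge0|lra|].
by apply: rint_sub => // z; exact: sqr_ge0.
Qed.

(** Only equality of the boundary terms matters: it holds for periodic factors,
    and when one factor vanishes at both ends. *)
Lemma rint_by_parts a b F f G g : a <= b -> continuous f -> continuous g ->
  (forall x, is_derive x 1 F (f x)) -> (forall x, is_derive x 1 G (g x)) ->
  F a * G a = F b * G b ->
  rint a b (fun x => F x * g x) = - rint a b (fun x => f x * G x).
Proof.
move=> ab cf cg dF dG E.
have cF := derive_continuous dF; have cG := derive_continuous dG.
apply/eqP; rewrite -addr_eq0 -rintD; [|by cont..].
apply/eqP; apply: (@rint_derive_endpoints _ _ (fun x => F x * G x)) => //.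
  by cont.
move=> x; have := is_deriveM (dF x) (dG x) => /is_derive_eq; apply.
by rewrite /GRing.scale/=; ring.
Qed.

Lemma continuous_eq0 f : continuous f -> (forall x, 0 < x < 1 -> f x = 0) ->
  f 0 = 0.
Proof.
move=> cf f0.
have h : f x @[x --> 0^'+] --> f 0 by apply: cvg_at_right_filter; exact: cf.
have h0 : f x @[x --> 0^'+] --> (0:R).
  apply: cvg_near_cst; near=> x; apply/f0/andP; split; near: x.
    exact: nbhs_right_gt.
  exact: nbhs_right_lt.
exact: (cvg_unique _ h h0).
Unshelve. all: by end_near. Qed.

(** The primitive of f based at a lies between 0 and the full integral, which
    is 0; so it is constant, and f is its derivative. *)
Lemma rint_eq0 a b f z : continuous f -> (forall x, 0 <= f x) ->
  rint a b f = 0 -> a < z < b -> f z = 0.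
Proof.
move=> cf f0 fi /andP[az zb].
have fi' : mu.-integrable `[a, b] (EFin \o f) by exact: continuous_integrable.
have [dF FE] := @continuous_FTC1_closed R f a z b zb fi' az (cf z).
move: FE; set F := (fun x => _).
suff FE : \forall x \near z, F x = 0.
  rewrite derive1E => <-.
  rewrite (@near_eq_derive _ _ _ F (cst 0))//; first by rewrite derive_cst.
near=> x.
have /andP[ax xb] : (a < x < b).
  suff : x \in `]a, b[ by rewrite in_itv.
  near: x; apply: near_in_itvoo; rewrite in_itv/= az zb //.
apply/eqP; rewrite eq_le; apply/andP; split; last exact: Rintegral_ge0.
by rewrite -fi; apply: rint_sub => //; exact: ltW.
Unshelve. all: by end_near. Qed.

End SegmentIntegral.

(** * Integrals depending on a parameter *)

Section ParameterIntegral.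
Variable R : realType.
Notation mu := (@lebesgue_measure R).

(** On the compact rectangle [s - 1, s + 1] x [a, b] the continuous derivative
    is bounded, and that bound dominates the difference quotients. *)
Lemma is_derive_rint (a b : R) (f fs : R -> R -> R) (s : R) :
  (forall s z : R, is_derive s 1 (f ^~ z) (fs s z)) ->
  (forall s, continuous (f s)) ->
  continuous (fun x : R * R => fs x.1 x.2) ->
  is_derive s 1 (fun s => rint a b (f s)) (rint a b (fs s)).
Proof.
move=> df cf cfs.
have fsE s' z : partial1of2 f s' z = fs s' z.
  by rewrite partial1of2E; have [_] := df s' z.
have sI : `]s - 1, s + 1[%classic s by rewrite /= in_itv/=; apply/andP; split; lra.
have [M [_ Mb]] : bounded_set ((fun x : R * R => fs x.1 x.2) @`
    (`[s - 1, s + 1] `*` `[a, b])).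
  apply: compact_bounded; apply: continuous_compact.
    exact: continuous_subspaceT.
  by apply: compact_setX; exact: segment_compact.
have Gub x y : `]s - 1, s + 1[%classic x -> `[a, b]%classic y ->
    `|partial1of2 f x y| <= cst (`|M| + 1) y.
  move=> /= xI yI; rewrite fsE.
  apply: (Mb (`|M| + 1)); first by have := ler_norm M; lra.
  by exists (x, y) => //=; split => //=; exact: subset_itv_oo_cc.
have intf x : `]s - 1, s + 1[%classic x ->
    mu.-integrable `[a, b] (EFin \o f x).
  by move=> _; exact: continuous_integrable.
have derf x y : `]s - 1, s + 1[%classic x -> `[a, b]%classic y ->
    derivable (f ^~ y) x 1 by move=> _ _; have [] := df x y.
have G0 y : 0 <= (cst (`|M| + 1) : R -> R) y by rewrite /cst addr_ge0.
have intG : mu.-integrable `[a, b] (EFin \o cst (`|M| + 1)).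
  by apply: continuous_integrable; exact: cont_cst.
have mB : measurable (`[a, b] : set R) by [].
have dF := @derivable_under_integral _ _ _ mu f `[a, b] mB s _ _ sI intf derf _ G0 intG Gub.
have eF := @differentiation_under_integral _ _ _ mu f `[a, b] mB s _ _ sI intf derf _ G0 intG Gub.
apply: DeriveDef => //.
rewrite -derive1E eF; apply: eq_Rintegral => z _; exact: fsE.
Qed.

Lemma cont_section (f : R -> R -> R) (s : R) :
  continuous (fun x : R * R => f x.1 x.2) -> continuous (f s).
Proof. by move=> cf; apply: (cont_comp2 cf); [exact: cont_cst|exact: cont_id]. Qed.

Lemma cont_section1 (f : R -> R -> R) (z : R) :
  continuous (fun x : R * R => f x.1 x.2) -> continuous (f ^~ z).
Proof. by move=> cf; apply: (cont_comp2 cf); [exact: cont_id|exact: cont_cst]. Qed.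

Lemma joint_bounded (f : R -> R -> R) (a b u v : R) :
  continuous (fun x : R * R => f x.1 x.2) ->
  exists M, forall s z, u <= s <= v -> a <= z <= b -> `|f s z| <= M.
Proof.
move=> cf.
have [M [_ Mb]] : bounded_set ((fun x : R * R => f x.1 x.2) @`
    (`[u, v] `*` `[a, b])).
  apply: compact_bounded; apply: continuous_compact.
    exact: continuous_subspaceT.
  by apply: compact_setX; exact: segment_compact.
exists (`|M| + 1) => s z sI zI.
apply: (Mb (`|M| + 1)); first by have := ler_norm M; lra.
by exists (s, z) => //=; split => /=; rewrite in_itv.
Qed.

Lemma cont_rint (a b : R) (f : R -> R -> R) :
  continuous (fun x : R * R => f x.1 x.2) ->
  continuous (fun s => rint a b (f s)).
Proof.
move=> cf s.
have [M Mb] := joint_bounded a b (s - 1) (s + 1) cf.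
have intf x : `]s - 1, s + 1[%classic x ->
    mu.-integrable `[a, b] (EFin \o f x).
  by move=> _; apply: continuous_integrable; exact: cont_section.
apply: (@continuity_under_integral _ _ _ mu f `[a, b] _ _ _ intf _ (cst M)) => //.
- apply: aeW => y _ x _; exact: cont_section1.
- by apply: continuous_integrable; exact: cont_cst.
- move=> x; rewrite /= in_itv/= => /andP[x1 x2]; apply: aeW => y /=.
  by rewrite in_itv/= => yI; apply: Mb => //; apply/andP; split; exact: ltW.
- by rewrite inE/= in_itv/=; apply/andP; split; lra.
Qed.

(** The derivative in s is bounded near (s0, z0), so f is Lipschitz in s
    uniformly in z, and continuity in z alone then suffices. *)
Lemma joint_cont (f fs : R -> R -> R) :
  (forall s z : R, is_derive s 1 (f ^~ z) (fs s z)) ->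
  (forall s, continuous (f s)) ->
  continuous (fun x : R * R => fs x.1 x.2) ->
  continuous (fun x : R * R => f x.1 x.2).
Proof.
move=> df cf cfs [s0 z0].
have [M Mb] := joint_bounded (z0 - 1) (z0 + 1) (s0 - 1) (s0 + 1) cfs.
apply/cvgrPdist_le => /= e e0.
pose d := Num.min 1 (e / 2 / (`|M| + 1)).
have d0 : 0 < d by rewrite lt_min ltr01/= !divr_gt0// ltr_wpDl.
have cfz : \forall z \near z0, `|f s0 z0 - f s0 z| <= e / 2.
  have /cvgrPdist_le := cf s0 z0; apply; lra.
have [r /= r0 rP] : \forall z \near z0, `|f s0 z0 - f s0 z| <= e / 2 by [].
pose d2 := Num.min d r.
have d20 : 0 < d2 by rewrite lt_min d0.
exists (ball s0 d2, ball z0 d2) => /=.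
  by split; apply/nbhs_ballP; exists d2.
move=> [s z] [/=]; rewrite /ball/= => sb zb.
have [sd sr] : `|s0 - s| < d /\ `|s0 - s| < r by move: sb; rewrite lt_min => /andP.
have [zd zr] : `|z0 - z| < d /\ `|z0 - z| < r by move: zb; rewrite lt_min => /andP.
have d1 : d <= 1 by rewrite ge_min lexx.
have dM : d * (`|M| + 1) <= e / 2.
  by rewrite -ler_pdivlMr ?ltr_wpDl// ge_min lexx orbT.
have h2 := rP z zr.
have h1 : `|f s0 z - f s z| <= e / 2.
  have mono x y : s0 - 1 <= x -> y <= s0 + 1 -> x <= y ->
      `|f y z - f x z| <= (`|M| + 1) * (y - x).
    move=> xs ys xy.
    have cg : continuous (f ^~ z) by exact: derive_continuous (df ^~ z).
    have [t + ->] := MVT_segment xy (fun (t : R) _ => df t z) (continuous_subspaceT cg).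
    rewrite in_itv/= => /andP[xt ty].
    rewrite normrM (ger0_norm (_ : 0 <= y - x)) ?subr_ge0// ler_wpM2r ?subr_ge0//.
    apply: (@le_trans _ _ M); last by have := ler_norm M; lra.
    apply: Mb; first by apply/andP; split; lra.
    by move: (lt_le_trans zd d1); rewrite ltr_norml => /andP[? ?]; apply/andP; split; lra.
  have M0 : 0 < `|M| + 1 by rewrite ltr_wpDl.
  move: (lt_le_trans sd d1); rewrite ltr_norml => /andP[l1 l2].
  apply: (@le_trans _ _ ((`|M| + 1) * `|s0 - s|)); last first.
    by rewrite (le_trans _ dM)// mulrC ler_wpM2r// ltW.
  have [ss|/ltW ss] := leP s s0.
    rewrite (ger0_norm (_ : 0 <= s0 - s)) ?subr_ge0//; apply: mono => //; lra.
  rewrite distrC (distrC s0) (ger0_norm (_ : 0 <= s - s0)) ?subr_ge0//; apply: mono => //; lra.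
rewrite -(subrKA (f s0 z)) (le_trans (ler_normD _ _))//; lra.
Qed.

End ParameterIntegral.

(** * Continuous partial derivatives imply differentiability *)

(** The expected differential L is only assumed to satisfy the first-order
    estimate; uniqueness of the differential turns it into differentiability. *)
Lemma differentiable_linear_approx (K : numFieldType) (V W : normedModType K)
    (f : V -> W) (L : {linear V -> W}) x : continuous L ->
  (forall e : K, 0 < e ->
     \forall h \near (0 : V), `|f (h + x) - f x - L h| <= e * `|h|) ->
  differentiable f x.
Proof.
move=> cL H.
have E : f \o shift x = cst (f x) + L +o_ (0 : V) id.
  apply/eqaddoP => e e0; near=> h.
  rewrite !fctE/= opprD addrA; near: h; exact: H.
have dE := diff_unique cL E.
by apply/diff_locallyP; rewrite dE.
Unshelve. all: by end_near. Qed.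

Section C1.
Variables (R : realType) (n : nat).
Implicit Types (f : 'rV[R]_n -> R) (x y v h : 'rV[R]_n).

(** The directional derivative moves along with the base point, which turns
    one-variable theorems into statements on lines. *)
Lemma is_derive_line f y v (t : R) : derivable f (y + t *: v) v ->
  is_derive t 1 (fun t => f (y + t *: v)) ('D_v f (y + t *: v)).
Proof.
move=> df.
have E : (fun h : R => h^-1 *: (f (h *: v + (y + t *: v)) - f (y + t *: v))) =
         (fun h : R => h^-1 *: (((fun t => f (y + t *: v)) \o shift t) (h *: (1:R)) -
                      f (y + t *: v))).
  apply/funext => h /=; rewrite [h *: 1]mulr1 scalerDl.
  by rewrite addrCA.
by apply: DeriveDef; [rewrite /derivable -E|rewrite /derive -E].
Qed.

Lemma line_mean_value f y v (k : R) : (forall y, derivable f y v) ->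
  exists2 t : R, `|t| <= `|k| & f (y + k *: v) - f y = k * 'D_v f (y + t *: v).
Proof.
move=> df; pose g t := f (y + t *: v).
have dg (t : R) : is_derive t 1 g ('D_v f (y + t *: v)) by exact: is_derive_line.
have cg : continuous g by exact: derive_continuous dg.
have [k0|/ltW k0] := leP 0 k.
- have [t + E] := MVT_segment k0 (fun (t : R) _ => dg t) (continuous_subspaceT cg).
  rewrite in_itv/= => /andP[t0 tk]; exists t; first by rewrite !ger0_norm.
  by move: E; rewrite /g scale0r addr0 subr0 mulrC.
- have [t + E] := MVT_segment k0 (fun (t : R) _ => dg t) (continuous_subspaceT cg).
  rewrite in_itv/= => /andP[kt t0]; exists t; first by rewrite !ler0_norm// lerN2.
  by move: E; rewrite /g scale0r addr0 -[RHS]opprK -[f _ - f y]opprB => ->; ring.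
Qed.

Lemma ler_mx_entry (x : 'rV[R]_n) i : `|x 0 i| <= `|x|.
Proof. by rewrite [leRHS]/Num.norm/= mx_normrE; exact: (le_bigmax _ _ (0, i)). Qed.

Lemma mx_norm_ler (x : 'rV[R]_n) (k : R) : 0 <= k -> (forall i, `|x 0 i| <= k) -> `|x| <= k.
Proof.
move=> k0 xk; rewrite [leLHS]/Num.norm/= mx_normrE.
by apply: bigmax_le => // -[i j] _ /=; rewrite ord1.
Qed.

(** [head h k] keeps the first k coordinates of h: these are the corners of the
    coordinate path from x to x + h. *)
Let head h (k : nat) : 'rV[R]_n := \row_(j < n) (if (j < k)%N then h 0 j else 0).

(** Go from x to x + h one coordinate at a time.  The mean value theorem on each
    edge produces a partial derivative at a point at distance at most |h| of x,
    which continuity at x compares with the one at x. *)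
Lemma differentiable_of_partials f x :
  (forall i y, derivable f y (delta_mx 0 i)) ->
  (forall i, {for x, continuous (partial i f)}) -> differentiable f x.
Proof.
move=> df cdf.
pose L h := \sum_(i < n) h 0 i * partial i f x.
have Llin : linear (L : 'rV[R]_n -> R).
  move=> k h h'; rewrite /L scaler_sumr -big_split/=; apply: eq_bigr => i _.
  by rewrite !mxE /GRing.scale/=; ring.
pose LM := GRing.isLinear.Build _ _ _ _ _ Llin.
pose LL : {linear 'rV[R]_n -> R} := HB.pack L LM.
have cL : continuous LL.
  rewrite /LL/= /L; apply: cont_sum => i; apply: cont_mul; last by cont.
  exact: coord_continuous.
apply: (@differentiable_linear_approx _ _ _ f LL) => // e e0.
have e' : 0 < e / (n%:R + 1) by rewrite divr_gt0// ltr_wpDl.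
have near_i (i : 'I_n) :
    \forall y \near x, `|partial i f x - partial i f y| <= e / (n%:R + 1).
  by move/cvgrPdist_le : (cdf i); apply.
have /nbhs_normP [d /= d0 dP] := filter_forall (nbhs_filter x) near_i.
  apply/nbhs_normP; exists d => //= h; rewrite /ball_/= sub0r normrN => hd.
  have tel : f (h + x) - f x = \sum_(i < n) (f (x + head h i.+1) - f (x + head h i)).
    rewrite -(big_mkord xpredT (fun i => f (x + head h i.+1) - f (x + head h i))).
    rewrite telescope_sumr//; congr (f _ - f _).
      by apply/rowP => j; rewrite !mxE ltn_ord addrC.
    by apply/rowP => j; rewrite !mxE addr0.
  rewrite tel /LL/= /L -sumrB.
  apply: (le_trans (ler_norm_sum _ _ _)).
  apply: (@le_trans _ _ (\sum_(i < n) (e / (n%:R + 1) * `|h|))); last first.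
    rewrite sumr_const card_ord -mulrnAl ler_wpM2r// -mulr_natl mulrCA ger_pMr//.
    by rewrite ler_pdivrMr ?ltr_wpDl// mul1r lerDl.
  apply: ler_sum => i _.
  (* the edge number i is parallel to the coordinate axis i *)
  have -> : head h i.+1 = head h i + h 0 i *: delta_mx 0 i.
    apply/rowP => j; rewrite !mxE ltnS leq_eqVlt eqxx/=.
    have [->|ji] := eqVneq j i; first by rewrite eqxx/= ltnn add0r mulr1.
    by move: ji; rewrite -val_eqE/= => /negPf ->; rewrite mulr0 addr0.
  rewrite addrA.
  have [t th ->] := line_mean_value (x + head h i) (h 0 i) (df i).
  rewrite -mulrBr normrM mulrC ler_pM//; last exact: ler_mx_entry.
  rewrite distrC dP//=.
  apply: le_lt_trans hd.
  rewrite -addrA opprD addNKr normrN; apply: mx_norm_ler => // j.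
  rewrite !mxE eqxx/=; have [->|ji] := eqVneq j i.
    by rewrite ltnn add0r mulr1 (le_trans th)//; exact: ler_mx_entry.
  rewrite mulr0 addr0; case: ifP => _; first exact: ler_mx_entry.
  by rewrite normr0.
Qed.

End C1.

(** * Calculus of continuously differentiable functions *)

Section C1Rules.
Variables (R : realType) (n : nat).
Implicit Types (f g : 'rV[R]_n -> R) (x y v h : 'rV[R]_n) (i : 'I_n).

(** [partial] is a total operator, so continuity of the partial derivatives alone
    carries no information; differentiability is what the chain rule needs. *)
Definition C1 f := (forall x, differentiable f x) /\
  (forall i, continuous (partial i f)).

Lemma c1_cont f : C1 f -> continuous f.
Proof. by move=> [df _] x; exact: differentiable_continuous. Qed.

Lemma c1_derivable f x v : C1 f -> derivable f x v.
Proof. by move=> [df _]; exact: diff_derivable. Qed.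

Lemma eq_c1 f g : f =1 g -> C1 g -> C1 f.
Proof. by move=> /funext ->. Qed.

Lemma partial_add f g i x : C1 f -> C1 g ->
  partial i (fun x => f x + g x) x = partial i f x + partial i g x.
Proof. by move=> cf cg; rewrite /partial deriveD//; exact: c1_derivable. Qed.

Lemma partial_mul f g i x : C1 f -> C1 g ->
  partial i (fun x => f x * g x) x = partial i f x * g x + f x * partial i g x.
Proof.
move=> cf cg; rewrite /partial deriveM//; try exact: c1_derivable.
by rewrite /GRing.scale/= addrC mulrC.
Qed.

Lemma partial_cst (k : R) i x : partial i (fun=> k) x = 0.
Proof. by rewrite /partial derive_cst. Qed.

Lemma partial_coord i j x : partial i (fun x => x 0 j) x = (i == j)%:R.
Proof.
rewrite /partial deriveE; last exact: differentiable_coord.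
have lc : linear (fun x : 'rV[R]_n => x 0 j) by move=> k y z; rewrite !mxE.
pose LM := GRing.isLinear.Build _ _ _ _ _ lc.
pose LL : {linear 'rV[R]_n -> R} := HB.pack (fun x : 'rV[R]_n => x 0 j) LM.
rewrite (_ : (fun x => _) = LL)// diff_lin/= ?mxE ?eqxx//=; last first.
  by move=> y; exact: coord_continuous.
by rewrite eq_sym.
Qed.

Lemma c1_cst k : C1 (fun=> k).
Proof.
split=> [x|i]; first exact: differentiable_cst.
by rewrite (_ : partial _ _ = fun=> 0); [exact: cont_cst|apply/funext => x; exact: partial_cst].
Qed.

Lemma c1_coord j : C1 (fun x => x 0 j).
Proof.
split=> [x|i]; first exact: differentiable_coord.
rewrite (_ : partial _ _ = fun=> ((i == j)%:R : R)); first exact: cont_cst.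
by apply/funext => x; exact: partial_coord.
Qed.

Lemma c1_add f g : C1 f -> C1 g -> C1 (fun x => f x + g x).
Proof.
move=> cf cg; split=> [x|i].
  by apply: differentiableD; [have [+ _] := cf|have [+ _] := cg]; exact.
rewrite (_ : partial _ _ = fun x => partial i f x + partial i g x).
  by apply: cont_add; [have [_] := cf|have [_] := cg]; exact.
by apply/funext => x; exact: partial_add.
Qed.

Lemma c1_mul f g : C1 f -> C1 g -> C1 (fun x => f x * g x).
Proof.
move=> cf cg; split=> [x|i].
  by apply: differentiableM; [have [+ _] := cf|have [+ _] := cg]; exact.
rewrite (_ : partial _ _ = fun x => partial i f x * g x + f x * partial i g x).
  apply: cont_add; apply: cont_mul; try exact: c1_cont.
    by have [_] := cf; exact.
  by have [_] := cg; exact.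
by apply/funext => x; exact: partial_mul.
Qed.

Lemma c1_opp f : C1 f -> C1 (fun x => - f x).
Proof.
move=> cf; apply: (@eq_c1 _ (fun x => -1 * f x)); first by move=> x; rewrite mulN1r.
by apply: c1_mul => //; exact: c1_cst.
Qed.

Lemma partial_opp f i x : C1 f -> partial i (fun x => - f x) x = - partial i f x.
Proof.
move=> cf; rewrite (_ : (fun x => - f x) = (fun x => -1 * f x)); last first.
  by apply/funext => y; rewrite mulN1r.
by rewrite partial_mul ?partial_cst; [ring|exact: c1_cst|].
Qed.

Lemma partial_periodic f y i : (forall x, f (x + y) = f x) ->
  forall x, partial i f (x + y) = partial i f x.
Proof.
move=> fy x; rewrite /partial /derive.
by under eq_fun do rewrite /= addrA !fy.
Qed.

Lemma derive_direction f x v : differentiable f x ->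
  'D_v f x = \sum_(i < n) v 0 i * partial i f x.
Proof.
move=> df; rewrite deriveE// {1}(row_sum_delta v) linear_sum.
by apply: eq_bigr => i _; rewrite linearZ/= /partial deriveE.
Qed.

Lemma is_derive_curve f (c : R -> 'rV[R]_n) (c' : 'rV[R]_n) (a : R) :
  differentiable f (c a) ->
  (forall i, is_derive a 1 (fun a => c a 0 i) (c' 0 i)) ->
  is_derive a 1 (fun a => f (c a)) (\sum_(i < n) c' 0 i * partial i f (c a)).
Proof.
move=> df dc.
have dca : derivable c a 1.
  by apply/derivable_mxP => i j; rewrite ord1; have [] := dc j.
have dc' : differentiable c a by apply/derivable1_diffP.
have cE : 'D_1 c a = c'.
  rewrite derive_mx//; apply/rowP => i; rewrite mxE.
  by have [_] := dc i.
apply: DeriveDef; first by apply: diff_derivable; exact: differentiable_comp.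
rewrite deriveE; last exact: differentiable_comp.
rewrite diff_comp//= -derive_direction// -cE.
by rewrite [in RHS]deriveE// [in RHS]deriveE.
Qed.

(** [smooth] speaks of partial derivatives alone; the chain rule becomes
    available through [differentiable_of_partials]. *)
Lemma smooth_c1 f : smooth f -> C1 f.
Proof.
move=> sf; split=> [x|i]; last by have [] := sf [:: i].
apply: differentiable_of_partials => [i y|i y].
- by have [_] := sf [::]; exact.
- by have [+ _] := sf [:: i]; apply.
Qed.

Lemma smooth_partial f i : smooth f -> smooth (partial i f).
Proof.
move=> sf s; have := sf (rcons s i).
by rewrite /iter_partial -cats1 foldr_cat.
Qed.

Lemma partial_entry m (u : 'rV[R]_n -> 'rV[R]_m) i j x :
  derivable u x (delta_mx 0 i) ->
  partial i u x 0 j = partial i (fun x => u x 0 j) x.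
Proof. by move=> du; rewrite /partial derive_mx// mxE. Qed.

Lemma smooth_entry m (u : 'rV[R]_n -> 'rV[R]_m) j : smooth u ->
  smooth (fun x => u x 0 j).
Proof.
move=> su.
have E s : iter_partial s (fun x => u x 0 j) = fun x => iter_partial s u x 0 j.
  elim: s => //= i s IH; apply/funext => x.
  by rewrite partial_entry ?IH//; have [_] := su s; exact.
move=> s; rewrite E; have [cs ds] := su s; split=> [x|i x].
  apply: (@continuous_comp _ _ _ (iter_partial s u) (fun v : 'rV[R]_m => v 0 j)); first exact: cs.
  exact: coord_continuous.
by move: (ds i x) => /derivable_mxP; exact.
Qed.

End C1Rules.

(** * Excluding logarithmic growth of the flux *)

Section LogGrowth.
Variable R : realType.

Lemma derive_ge0_le (f f' : R -> R) (x y : R) : x <= y ->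
  (forall t : R, x <= t <= y -> is_derive t 1 f (f' t)) ->
  (forall t, x <= t <= y -> 0 <= f' t) -> f x <= f y.
Proof.
move=> xy df f0.
have cf : {within `[x, y], continuous f}.
  apply: derivable_within_continuous => t; rewrite in_itv/= => tI.
  by have [] := df t tI.
have df' t : t \in `]x, y[ -> is_derive t 1 f (f' t).
  by rewrite in_itv/= => /andP[xt ty]; apply: df; rewrite !ltW.
have [t + E] := MVT_segment xy df' cf.
rewrite in_itv/= => tI; rewrite -subr_ge0 E mulr_ge0 ?subr_ge0//; exact: f0.
Qed.

(** Here e is the energy of a slice, K the flux, and Y the sum of the terms that
    are not monotone.  By the lower bound on y = Y', the function
    Z = Y + (C1 / c) K - k ln s is nondecreasing.  As K is bounded and ln s is
    not, Y must tend to infinity, and then so must e; but e >= 1 beyond some s2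
    gives K' >= 1 there, against the bound on K. *)
Lemma no_log_growth (K Y y e : R -> R) (c k s1 C1 C2 C3 Kmax : R) :
  1 <= c -> 0 < k -> 1 <= s1 -> 0 < C3 ->
  (forall s : R, s1 <= s -> is_derive s 1 K (c * s * e s)) ->
  (forall s : R, s1 <= s -> is_derive s 1 Y (y s)) ->
  (forall s, s1 <= s -> 0 <= e s) ->
  (forall s, s1 <= s -> k / s <= y s + C1 * s * e s) ->
  (forall s, s1 <= s -> Y s <= C2 + C3 * e s) ->
  (forall s, s1 <= s -> K s <= Kmax) -> False.
Proof.
move=> c1 k0 s11 C30 dK dY e0 Hk HY HK.
have cn0 : c != 0 by rewrite gt_eqF//; lra.
pose Z s := Y s + (C1 / c) * K s - k * ln s.
have dZ (s : R) : s1 <= s -> is_derive s 1 Z (y s + C1 * s * e s - k / s).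
  move=> ss; have s0 : 0 < s by lra.
  have h1 := is_deriveB (is_deriveD (dY s ss) (is_deriveZ (C1 / c) (dK s ss)))
    (is_deriveZ k (is_derive1_ln s0)).
  apply: is_derive_eq h1 _; rewrite /GRing.scale/=.
  by congr (_ + _ - _); field.
have Zmono s : s1 <= s -> Z s1 <= Z s.
  move=> ss; apply: (@derive_ge0_le Z (fun s => y s + C1 * s * e s - k / s)) => //.
    by move=> t /andP[st _]; exact: dZ.
  by move=> t /andP[st _]; rewrite subr_ge0 Hk.
(* C1 may have either sign: use the upper bound on K or its monotonicity *)
have C1c : exists C, forall s, s1 <= s -> (C1 / c) * K s <= C.
  have [h|/ltW h] := leP 0 (C1 / c).
    by exists (C1 / c * Kmax) => s ss; rewrite ler_wpM2l// HK.
  exists (C1 / c * K s1) => s ss; rewrite ler_wnM2l//.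
  apply: (derive_ge0_le ss) => t /andP[st _]; first exact: dK.
  by rewrite !mulr_ge0 ?e0//; lra.
have [C HC] := C1c.
(* k ln s exceeds C3 + C2 + C - Z s1 as soon as ln s >= T, and then
   C2 + C3 e >= Y >= C2 + C3 *)
pose T := `|(C3 + C2 + C - Z s1) / k|.
pose s2 := Num.max s1 (expR T).
have e1 s : s2 <= s -> 1 <= e s.
  rewrite ge_max => /andP[ss Ts].
  have s0 : 0 < s by lra.
  have lnT : T <= ln s by rewrite -(expRK T) ler_ln// ?posrE// expR_gt0.
  have h1 := Zmono s ss; have h2 := HY s ss; have h3 := HC s ss.
  have h4 : C3 + C2 + C - Z s1 <= k * ln s.
    rewrite mulrC -ler_pdivrMr//; apply: le_trans lnT; exact: ler_norm.
  rewrite -(ler_pM2l C30) mulr1; rewrite /Z in h1 h4 *; lra.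
have s2s1 : s1 <= s2 by rewrite /s2 le_max lexx.
(* at this s3, the inequality K s3 - s3 >= K s2 - s2 reads K s3 > Kmax *)
pose s3 := s2 + `|Kmax - K s2| + 1.
have s23 : s2 <= s3 by rewrite /s3 -addrA lerDl addr_ge0.
have := @derive_ge0_le (fun s => K s - s) (fun s => c * s * e s - 1) s2 s3 s23.
have -> : (forall t, s2 <= t <= s3 -> 0 <= c * t * e t - 1) = True.
  rewrite propeqE; split=> // _ t /andP[s2t _].
  have := e1 t s2t; have : 1 <= c * t by rewrite -(mulr1 1) ler_pM//; lra.
  move=> h1 h2; rewrite subr_ge0 -(mulr1 1) ler_pM//; lra.
have h : forall t : R, s2 <= t <= s3 -> is_derive t 1 (fun s => K s - s) (c * t * e t - 1).
  move=> t /andP[s2t _]; apply: (is_deriveB (dK t _)); lra.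
move=> /(_ h I).
have := HK s3 (le_trans s2s1 s23); have := ler_norm (Kmax - K s2).
have : s3 = s2 + `|Kmax - K s2| + 1 by [].
lra.
Qed.

End LogGrowth.

(** * The stream function on a half-plane *)

Section StreamFunction.
Variables (R : realType) (a c : R) (v vs vz w : R -> R -> R).
Hypothesis cv : continuous (fun x : R * R => v x.1 x.2).
Hypothesis cvs : continuous (fun x : R * R => vs x.1 x.2).
Hypothesis cvz : continuous (fun x : R * R => vz x.1 x.2).
Hypothesis dvs : forall s z : R, is_derive s 1 (v ^~ z) (vs s z).
Hypothesis dvz : forall s z : R, is_derive z 1 (v s) (vz s z).
Hypothesis dws : forall s z : R, is_derive s 1 (w ^~ z) (- c * s * vz s z).
Hypothesis w0 : forall z, w 0 z = 0.

(** Substituting y = t s, this is minus the integral of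
    c y (v(y, z) - v(y, a)) over 0 <= y <= s.  The form over the fixed segment
    [0, 1] is smooth in s by differentiation under the integral, and makes sense
    for s of any sign.  Subtracting v(y, a) makes it vanish at
    z = a and leaves its z-derivative unchanged. *)
Definition stream (s z : R) : R :=
  - c * s ^+ 2 * rint 0 1 (fun t => t * (v (t * s) z - v (t * s) a)).

(** Differentiate under the integral, then recognize the result as the endpoint
    value of t^2 (v(t s, z) - v(t s, a)) at t = 1. *)
Lemma stream_s (s z : R) :
  is_derive s 1 (stream ^~ z) (- c * s * (v s z - v s a)).
Proof.
pose f (s t : R) := t * (v (t * s) z - v (t * s) a).
pose fs (s t : R) := t ^+ 2 * (vs (t * s) z - vs (t * s) a).
have dvt (y s' t : R) : is_derive s' 1 (fun s => v (t * s) y) (t * vs (t * s') y).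
  have h1 := is_deriveZ t (is_derive_id s' (1 : R)).
  have := is_derive1_comp (f := v ^~ y) (dvs (t * s') y) h1.
  by move=> /is_derive_eq; apply; rewrite /GRing.scale/= ?mulr1; ring.
have df (s' t : R) : is_derive s' 1 (f ^~ t) (fs s' t).
  have := is_deriveZ t (is_deriveB (dvt z s' t) (dvt a s' t)).
  by move=> /is_derive_eq; apply; rewrite /GRing.scale/= /fs; ring.
have cf s' : continuous (f s') by rewrite /f; cont.
have cfs : continuous (fun x : R * R => fs x.1 x.2) by rewrite /fs; cont.
have dI := is_derive_rint 0 1 s df cf cfs.
have ds2 : is_derive s 1 (fun s : R => - c * s ^+ 2) (- c * (2 * s)).
  have := is_deriveZ (- c) (is_deriveX 2 (is_derive_id s (1 : R))).
  by move=> /is_derive_eq; apply; rewrite /GRing.scale/=; ring.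
have := is_deriveM ds2 dI; move=> /is_derive_eq; apply; rewrite /GRing.scale/=.
(* with g = v(., z) - v(., a), d/dt (t^2 g(t s)) = 2 t g(t s) + s t^2 g'(t s) *)
have dt (t : R) : is_derive t 1 (fun t => t ^+ 2 * (v (t * s) z - v (t * s) a))
    (2 * f s t + s * fs s t).
  have dvt' (y : R) : is_derive t 1 (fun t => v (t * s) y) (s * vs (t * s) y).
    by have := dvt y t s; rewrite ![s * _]mulrC; under eq_fun do rewrite mulrC.
  have := is_deriveM (is_deriveX 2 (is_derive_id t (1 : R))) (is_deriveB (dvt' z) (dvt' a)).
  by move=> /is_derive_eq; apply; rewrite /GRing.scale/= /f /fs ?fctE ?expr1; ring.
have cfs1 : continuous (fs s) by exact: (@cont_section _ fs s cfs).
have := rint_FTC ler01 _ dt.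
rewrite rintD; [|by rewrite ?/f ?/fs; cont..].
rewrite rintZ// rintZ// !mul1r expr1n mul1r expr0n/= !mul0r subr0.
move=> <-; last by rewrite /f /fs; cont.
by rewrite /f; ring.
Qed.

(** The integrand of the z-derivative is the t-derivative of w(t s, z), by the
    divergence-free relation [dws]; and w vanishes on the axis s = 0. *)
Lemma stream_z (s z : R) : is_derive z 1 (stream s) (w s z).
Proof.
pose f (y t : R) := t * (v (t * s) y - v (t * s) a).
pose fz (y t : R) := t * vz (t * s) y.
have df (y t : R) : is_derive y 1 (f ^~ t) (fz y t).
  have := is_deriveZ t (is_deriveB (dvz (t * s) y) (is_derive_cst (v (t * s) a) y 1)).
  by move=> /is_derive_eq; apply; rewrite /GRing.scale/= /fz subr0.
have cf s' : continuous (f s') by rewrite /f; cont.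
have cfz : continuous (fun x : R * R => fz x.1 x.2) by rewrite /fz; cont.
have dI := is_derive_rint 0 1 z df cf cfz.
have := is_deriveZ (- c * s ^+ 2) dI; move=> /is_derive_eq; apply; rewrite /GRing.scale/=.
have dwt (t : R) : is_derive t 1 (fun t => w (t * s) z) (- c * s ^+ 2 * fz z t).
  have h1 : is_derive t 1 (fun t : R => t * s) s.
    have := is_deriveM (is_derive_id t (1 : R)) (is_derive_cst s t 1).
    by move=> /is_derive_eq; apply; rewrite /GRing.scale/=; ring.
  have := @is_derive1_comp _ (w ^~ z) (fun t => t * s) t _ _ (dws (t * s) z) h1.
  by move=> /is_derive_eq; apply; rewrite /GRing.scale/= /fz; ring.
have cfz1 : continuous (fz z) by exact: (@cont_section _ fz z cfz).
rewrite -rintZ// (rint_FTC ler01 _ dwt); last by cont.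
by rewrite mul1r mul0r w0 subr0.
Qed.

Lemma stream_cont : continuous (fun x : R * R => stream x.1 x.2).
Proof.
apply: (joint_cont stream_s); last by cont.
by move=> s; exact: derive_continuous (stream_z s).
Qed.

Lemma stream_periodic (b s : R) : (forall s, v s a = v s b) -> stream s b = 0.
Proof.
move=> vab; rewrite /stream (@eq_rint _ _ _ _ (fun=> 0)) ?rint_cst// ?mulr0//.
by move=> t; rewrite vab subrr mulr0.
Qed.

Lemma stream_base s : stream s a = 0.
Proof. exact: stream_periodic. Qed.

End StreamFunction.

(** * The energy flux through a half-plane *)

Section Young.
Variable R : realType.
Implicit Types x y d g s m : R.

Lemma young x y : x * y <= (x ^+ 2 + y ^+ 2) / 2.
Proof. by have := sqr_ge0 (x - y); lra. Qed.

(** For a term x y that is linear in the small quantity x, with y merely bounded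
    by 2: the free weight d lets the constant part be as small as wished. *)
Lemma young_weight x y d : 0 < d -> y ^+ 2 <= 4 -> - (x * y) <= d + x ^+ 2 / d.
Proof.
move=> d0 y4; rewrite -(ler_pM2r d0) mulrDl divfK ?gt_eqF//.
have h1 := sqr_ge0 (d + x * y / 2).
have h2 : 0 <= x ^+ 2 * (4 - y ^+ 2) by rewrite mulr_ge0 ?sqr_ge0 ?subr_ge0.
lra.
Qed.

Lemma young_factor g m x s : m ^+ 2 <= 4 * s ^+ 2 ->
  - (g * m * x) <= g ^+ 2 + s ^+ 2 * x ^+ 2.
Proof.
move=> ms; have h1 := sqr_ge0 (g + m * x / 2).
have h2 : 0 <= x ^+ 2 * (4 * s ^+ 2 - m ^+ 2) by rewrite mulr_ge0 ?sqr_ge0 ?subr_ge0.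
lra.
Qed.

Lemma young_unit g m y s : m ^+ 2 <= 1 ->
  - (s * (g * m * y)) <= (g ^+ 2 + s ^+ 2 * y ^+ 2) / 2.
Proof.
move=> m1; have h1 := sqr_ge0 (s * y + g * m).
have h2 : 0 <= g ^+ 2 * (1 - m ^+ 2) by rewrite mulr_ge0 ?sqr_ge0 ?subr_ge0.
lra.
Qed.

End Young.

Section RayEnergy.
Variables (R : realType) (a b c : R).
Variables (v vs vz vzz w wz q qs p pz E F Fz G : R -> R -> R).
Hypothesis ab : a < b.
Hypothesis c1 : 1 <= c.
Hypothesis cvs : continuous (fun x : R * R => vs x.1 x.2).
Hypothesis cvz : continuous (fun x : R * R => vz x.1 x.2).
Hypothesis cvzz : continuous (fun x : R * R => vzz x.1 x.2).
Hypothesis cw : continuous (fun x : R * R => w x.1 x.2).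
Hypothesis cwz : continuous (fun x : R * R => wz x.1 x.2).
Hypothesis cq : continuous (fun x : R * R => q x.1 x.2).
Hypothesis cqs : continuous (fun x : R * R => qs x.1 x.2).
Hypothesis cp : continuous (fun x : R * R => p x.1 x.2).
Hypothesis cpz : continuous (fun x : R * R => pz x.1 x.2).
Hypothesis cE : continuous (fun x : R * R => E x.1 x.2).
Hypothesis cFz : continuous (fun x : R * R => Fz x.1 x.2).
Hypothesis cG : continuous (fun x : R * R => G x.1 x.2).
Hypothesis cv : continuous (fun x : R * R => v x.1 x.2).
Hypothesis dvz : forall s z : R, is_derive z 1 (v s) (vz s z).
Hypothesis dvzz : forall s z : R, is_derive z 1 (vz s) (vzz s z).
Hypothesis dwz : forall s z : R, is_derive z 1 (w s) (wz s z).
Hypothesis dqs : forall s z : R, is_derive s 1 (q ^~ z) (qs s z).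
Hypothesis dpz : forall s z : R, is_derive z 1 (p s) (pz s z).
Hypothesis dFz : forall s z : R, is_derive z 1 (F s) (Fz s z).
Hypothesis dGs : forall s z : R, is_derive s 1 (G ^~ z) (- c * s * (v s z - v s a)).
Hypothesis dGz : forall s z : R, is_derive z 1 (G s) (w s z).
Hypothesis Ga : forall s, G s a = 0.
Hypothesis Gb : forall s, G s b = 0.
Hypothesis Fab : forall s, F s a = F s b.
Hypothesis w0 : forall z, w 0 z = 0.

(** The axial momentum equation in the form d_s (s v_s) = [momentum]. *)
Definition momentum (s z : R) :=
  w s z * vs s z + c * s * (v s z * vz s z + pz s z - vzz s z).

Hypothesis dm : forall s z : R,
  is_derive s 1 (fun s => s * vs s z) (momentum s z).
Hypothesis dk : forall s z : R,
  is_derive s 1 (fun s => s * qs s z - w s z * (q s z + p s z))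
    (c * s * (E s z - Fz s z)).
Hypothesis E0 : forall s z, 0 <= E s z.
Hypothesis vsE : forall s z, vs s z ^+ 2 <= c * E s z.
Hypothesis vzE : forall s z, vz s z ^+ 2 <= E s z.
Hypothesis wzE : forall s z, wz s z ^+ 2 <= c * s ^+ 2 * E s z.

Let sec (f : R -> R -> R) (s : R) : continuous (fun x : R * R => f x.1 x.2) -> continuous (f s).
Proof. exact: cont_section. Qed.

Let e s := rint a b (E s).
Let K s := rint a b (fun z => s * qs s z - w s z * (q s z + p s z)).
Let Q s := rint a b (q s).
Let M s := rint a b (fun z => G s z * (s * vs s z)).
Let Ms s := rint a b (fun z =>
  - c * s * (v s z - v s a) * (s * vs s z) + G s z * momentum s z).
(** The part of c s K that is not a derivative in s, after the pressure and
    v_zz have been integrated by parts against G.  The first term is linear in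
    w; in the others, two factors among w, G, v - v(s, a), v_s, v_z are controlled
    by e, and any further factor is at most of order s. *)
Let rho s z := - (c * s * (w s z * q s z)) + c * s ^+ 2 * ((v s z - v s a) * vs s z)
  - G s z * w s z * vs s z - c * s * (G s z * v s z * vz s z) - c * s * (w s z * vz s z).

Ltac econt := rewrite ?/rho ?/momentum; cont.

Let e_ge0 s : 0 <= e s. Proof. by apply: rint_ge0. Qed.

Let e_cont : continuous e. Proof. exact: cont_rint. Qed.

Let dK (s : R) : is_derive s 1 K (c * s * e s).
Proof.
have cFsz : continuous (Fz s) by exact: sec.
have cEs : continuous (E s) by exact: sec.
have -> : c * s * e s = rint a b (fun z => c * s * (E s z - Fz s z)).
  rewrite rintZ; last by econt.
  congr (_ * _); rewrite (@eq_rint _ _ _ _ (fun z => E s z + -1 * Fz s z)); last by move=> z; ring.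
  rewrite rintD; [|by econt..].
  rewrite rintZ// (rint_FTC (ltW ab) cFsz (dFz s)) Fab; rewrite /e; ring.
apply: is_derive_rint => //.
- by move=> s'; econt.
- by econt.
Qed.

Let K0 : K 0 = 0.
Proof.
rewrite /K (@eq_rint _ _ _ _ (fun=> 0)) ?rint_cst ?mulr0 ?ltW// => z.
by rewrite w0 !mul0r subrr.
Qed.

Let K_le x y : 0 <= x -> x <= y -> K x <= K y.
Proof.
move=> x0 xy; apply: (derive_ge0_le xy) => t /andP[xt ty]; first exact: dK.
have c0 : 0 <= c := le_trans ler01 c1.
have t0 : 0 <= t := le_trans x0 xt.
by rewrite mulr_ge0 ?e_ge0// mulr_ge0.
Qed.

Let dQ (s : R) : is_derive s 1 Q (rint a b (qs s)).
Proof. by apply: is_derive_rint => // s'; exact: sec. Qed.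

Let dM (s : R) : is_derive s 1 M (Ms s).
Proof.
apply: (@is_derive_rint _ a b (fun s z => G s z * (s * vs s z))
  (fun s z => - c * s * (v s z - v s a) * (s * vs s z) + G s z * momentum s z)).
- move=> s' z.
  have := is_deriveM (dGs s' z) (dm s' z).
  by move=> /is_derive_eq; apply; rewrite /GRing.scale/=; ring.
- by move=> s'; econt.
- by rewrite /momentum; econt.
Qed.

(** Integrating by parts in z turns -int w p into int G p_z, and the same step
    turns int G v_zz into -int w v_z; the boundary terms vanish with G.  The
    value of int G p_z is then read off M' = int (G_s s v_s + G d_s (s v_s)),
    where d_s (s v_s) is [momentum]. *)
Lemma flux_identity s :
  c * s * K s = c * s ^+ 2 * rint a b (qs s) + Ms s + rint a b (rho s).
Proof.
have Gp : rint a b (fun z => G s z * pz s z) = - rint a b (fun z => w s z * p s z).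
  by apply: rint_by_parts => //; [exact: ltW|exact: sec|exact: sec|rewrite Ga Gb !mul0r].
have Gv : rint a b (fun z => G s z * vzz s z) = - rint a b (fun z => w s z * vz s z).
  by apply: rint_by_parts => //; [exact: ltW|exact: sec|exact: sec|rewrite Ga Gb !mul0r].
have H1 : Ms s + rint a b (rho s) = c * s * (- rint a b (fun z => w s z * q s z)
    - rint a b (fun z => w s z * p s z)).
  rewrite /Ms -rintD; [|by econt..].
  rewrite (@eq_rint _ _ _ _ (fun z => c * s * (-1 * (w s z * q s z) + G s z * pz s z
    + -1 * (G s z * vzz s z) + -1 * (w s z * vz s z)))); last first.
    by move=> z; rewrite /rho /momentum; ring.
  rewrite rintZ; last by econt.
  rewrite rintD; [|by econt..].
  rewrite rintD; [|by econt..].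
  rewrite rintD; [|by econt..].
  rewrite rintZ; last by econt.
  rewrite rintZ; last by econt.
  rewrite rintZ; last by econt.
  by rewrite Gp Gv; ring.
rewrite -addrA H1 /K.
rewrite (@eq_rint _ _ _ _ (fun z => s * qs s z + (-1 * (w s z * q s z) + -1 * (w s z * p s z)))); last first.
  by move=> z; ring.
rewrite rintD; [|by econt..].
rewrite rintD; [|by econt..].
rewrite rintZ; last by econt.
rewrite rintZ; last by econt.
rewrite rintZ; last by econt.
ring.
Qed.

(** By Rolle, w = G_z has a zero on the segment, as G vanishes at both ends: in
    a period the mean radial flux through the cylinder of radius r is zero.  So
    the Poincare inequality applies to w, with no mean value to subtract. *)
Let w_sqr s z : a <= z <= b -> w s z ^+ 2 <= (b - a) * (c * s ^+ 2 * e s).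
Proof.
move=> zab.
have cGs : continuous (G s) by exact: sec.
have [y yab dy] : exists2 y : R, y \in `]a, b[ & is_derive y 1 (G s) 0.
  have dG x : x \in `]a, b[ -> derivable (G s) x 1 by move=> _; have [] := dGz s x.
  apply: (Rolle ab dG (continuous_subspaceT cGs)).
  by rewrite Ga Gb.
have wy : w s y = 0.
  by have [_ <-] := dGz s y; have [_ ->] := dy.
have yab' : a <= y <= b by move: yab; rewrite in_itv/= => /andP[? ?]; rewrite !ltW.
have cwzs : continuous (wz s) by exact: sec.
have := sqr_osc_le cwzs (dwz s) zab yab'.
rewrite wy subr0 => /le_trans; apply.
apply: ler_wpM2l; first by rewrite subr_ge0 ltW.
rewrite /e -rintZ; last by econt.
by apply: le_rint => [||x _]; [econt|econt|exact: wzE].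
Qed.

Let G_sqr s z : a <= z <= b ->
  G s z ^+ 2 <= (b - a) ^+ 3 * (c * s ^+ 2 * e s).
Proof.
move=> zab.
have cws : continuous (w s) by exact: sec.
have aab : a <= a <= b by rewrite lexx ltW.
have := sqr_osc_le cws (dGz s) zab aab.
rewrite Ga subr0 => /le_trans; apply.
have -> : (b - a) ^+ 3 * (c * s ^+ 2 * e s) =
    (b - a) * ((b - a) * ((b - a) * (c * s ^+ 2 * e s))) by ring.
apply: ler_wpM2l; first by rewrite subr_ge0 ltW.
rewrite -rint_cst ?(ltW ab)//.
by apply: le_rint => [||x xab]; [econt|econt|exact: w_sqr].
Qed.

Let v_sqr s z : a <= z <= b -> (v s z - v s a) ^+ 2 <= (b - a) * e s.
Proof.
move=> zab.
have cvzs : continuous (vz s) by exact: sec.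
have aab : a <= a <= b by rewrite lexx ltW.
have := sqr_osc_le cvzs (dvz s) zab aab.
move=> /le_trans; apply; apply: ler_wpM2l; first by rewrite subr_ge0 ltW.
by apply: le_rint => [||x _]; [econt|econt|exact: vzE].
Qed.

(** Young's inequality on G (s v_s), then the bounds on G and v_s. *)
Let M_bound s : 0 < s -> M s <= s ^+ 2 * c * (((b - a) ^+ 4 + 1) * e s) / 2.
Proof.
move=> s0.
have -> : s ^+ 2 * c * (((b - a) ^+ 4 + 1) * e s) / 2 =
   rint a b (fun z => 2^-1 * (s ^+ 2 * c) * E s z + 2^-1 * ((b - a) ^+ 3 * (c * s ^+ 2 * e s))).
  rewrite rintD; [|by econt..].
  rewrite rintZ ?rint_cst; [|exact: ltW|by econt].
  by rewrite -/(e s); field.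
apply: le_rint; [by econt|by econt|move=> z zab].
have := G_sqr s zab; have := vsE s z.
have : 0 <= (G s z - s * vs s z) ^+ 2 by exact: sqr_ge0.
set g := G s z; set A := _ * (_ * e s).
have s20 : 0 <= s ^+ 2 by exact: sqr_ge0.
move=> h1 /(ler_wpM2l s20); lra.
Qed.

Let Ce := c * (b - a) / 2 + c * (b - a) ^+ 3 + c ^+ 2 * (b - a) ^+ 3 / 2
  + c ^+ 2 * (b - a) / 2.
Let CE := c ^+ 2 / 2 + 2 * c.

(** Each of the five terms of rho is estimated by one of the inequalities above.
    The hypotheses on v, q, w are pointwise bounds valid far from the axis.  Only
    the linear term -c s w q produces a term without e; it comes with the
    free factor d, at the price of a coefficient s^3 / d on e. *)
Let rho_bound s d : 0 < s -> 0 < d ->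
  (forall z, v s z ^+ 2 <= 1) -> (forall z, q s z ^+ 2 <= 4) ->
  (forall z, w s z ^+ 2 <= 4 * s ^+ 2) ->
  rint a b (rho s) <= (b - a) * (c * s * d)
    + s ^+ 3 * ((b - a) ^+ 2 * c ^+ 2 / d) * e s
    + s ^+ 2 * ((b - a) * Ce + CE) * e s.
Proof.
move=> s0 d0 v1 q2 w2.
have c0 : 0 < c := lt_le_trans ltr01 c1.
have dn : d != 0 by rewrite gt_eqF.
have -> : (b - a) * (c * s * d) + s ^+ 3 * ((b - a) ^+ 2 * c ^+ 2 / d) * e s
    + s ^+ 2 * ((b - a) * Ce + CE) * e s =
  rint a b (fun z => s ^+ 2 * CE * E s z + (c * s * d + s ^+ 3 * ((b - a) * c ^+ 2 / d) * e s
    + s ^+ 2 * Ce * e s)).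
  rewrite rintD; [|by econt..].
  rewrite rintZ ?rint_cst; [|exact: ltW|by econt].
  by rewrite -/(e s); field.
apply: le_rint; [by econt|by econt|move=> z zab].
have := w_sqr s zab; have := G_sqr s zab; have := v_sqr s zab.
have := vsE s z; have := vzE s z; have := v1 z; have := q2 z; have := w2 z.
rewrite /rho.
set g := G s z; set om := w s z; set nu := v s z - v s a; set x := vs s z; set y := vz s z.
set qq := q s z; set vv := v s z; set ee := e s; set ep := E s z.
move=> Hw Hq Hv Hy Hx Hn Hg Ho.
have s2 : 0 <= s ^+ 2 by exact: sqr_ge0.
have h2 : 0 <= (2 : R)^-1 by rewrite invr_ge0.
have s2x := ler_wpM2l s2 Hx; have s2y := ler_wpM2l s2 Hy.
have T1 : - (om * qq) <= d + ((b - a) * (c * s ^+ 2 * ee)) / d.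
  apply: (le_trans (young_weight om d0 Hq)).
  by rewrite lerD2l ler_wpM2r// invr_ge0 ltW.
have T2 : nu * x <= ((b - a) * ee + c * ep) / 2.
  by apply: (le_trans (young nu x)); rewrite ler_wpM2r// lerD.
have T3 : - (g * om * x) <= (b - a) ^+ 3 * (c * s ^+ 2 * ee) + s ^+ 2 * (c * ep).
  by apply: (le_trans (young_factor g x Hw)); rewrite lerD.
have T4 : - (s * (g * vv * y)) <= ((b - a) ^+ 3 * (c * s ^+ 2 * ee) + s ^+ 2 * ep) / 2.
  by apply: (le_trans (young_unit g y s Hv)); rewrite ler_wpM2r// lerD.
have T5 : - (s * (om * y)) <= ((b - a) * (c * s ^+ 2 * ee) + s ^+ 2 * ep) / 2.
  have -> : - (s * (om * y)) = - om * (s * y) by ring.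
  by apply: (le_trans (young (- om) (s * y))); rewrite sqrrN exprMn ler_wpM2r// lerD.
have {}T1 := ler_wpM2l (ltW (mulr_gt0 c0 s0)) T1.
have {}T2 := ler_wpM2l (mulr_ge0 (ltW c0) s2) T2.
have {}T4 := ler_wpM2l (ltW c0) T4.
have {}T5 := ler_wpM2l (ltW c0) T5.
rewrite /Ce /CE.
have := lerD (lerD (lerD (lerD T1 T2) T3) T4) T5.

set X := (X in X <= _ -> _); set X' := (X in _ -> X <= _).
have -> : X' = X by rewrite /X /X'; ring.
set Z := (X in _ <= X -> _); set Z' := (X in _ -> _ <= X).
have -> // : Z' = Z by rewrite /Z /Z'; field.
Qed.

Hypothesis far_bounds : exists s1, forall s z, s1 <= s ->
  [/\ v s z ^+ 2 <= 1, q s z ^+ 2 <= 4 & w s z ^+ 2 <= 4 * s ^+ 2].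
Hypothesis finite_energy : exists D, forall S, 0 <= S ->
  rint 0 S (fun s => s * e s) <= D.

(** [no_log_growth] applied to Y = Q + M / (c s^2) from a point where K = k > 0.
    Its lower bound on Y' is [flux_identity] divided by c s^2; the remaining terms
    of Y' and of rho are at most a constant times s e. *)
Let flux_le0 s : 0 <= s -> K s <= 0.
Proof.
move=> s0; rewrite leNgt; apply/negP => Ks.
have [s1 far] := far_bounds; have [D HD] := finite_energy.
have c0 : 0 < c := lt_le_trans ltr01 c1.
have cn : c != 0 by rewrite gt_eqF.
pose l := b - a; have l0 : 0 < l by rewrite subr_gt0.
have ln : l != 0 by rewrite gt_eqF.
pose k := K s.
(* with this d, the part of rho without e uses up exactly half of c t k *)
pose d := k / (2 * l).
have d0 : 0 < d by rewrite divr_gt0// mulr_gt0.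
have kn : k != 0 by rewrite gt_eqF.
pose s2 := Num.max 1 (Num.max s s1).
have s2P t : s2 <= t -> [/\ 1 <= t, s <= t & s1 <= t].
  by rewrite !ge_max => /and3P[].
pose Y t := Q t + c^-1 * (M t * t ^- 2).
(* the derivative of Y *)
pose y t := rint a b (qs t) + (Ms t / (c * t ^+ 2) - 2 * M t / (c * t ^+ 3)).
pose C1 := l ^+ 2 * c / d + ((l * Ce + CE) / c + l ^+ 4 + 1).
(* 2 l bounds Q, and (l^4 + 1) e bounds M / (c s^2); finiteness of the total
   energy bounds K by c D *)
apply: (@no_log_growth R K Y y e c (k / 2) s2 C1 (2 * l) (l ^+ 4 + 1) (c * D)) => //.
- by rewrite divr_gt0.
- by rewrite le_max lexx.
- by rewrite ltr_wpDl// exprn_ge0// ltW.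
- move=> t /s2P[t1 _ _].
  have t0 : 0 < t := lt_le_trans ltr01 t1.
  have tn : t != 0 by rewrite gt_eqF.
  have tn2 : t ^+ 2 != 0 by rewrite expf_neq0.
  have dV := is_deriveV (f := fun t : R => t ^+ 2) tn2 (is_deriveX 2 (is_derive_id t (1 : R))).
  have := is_deriveD (dQ t) (is_deriveZ c^-1 (is_deriveM (dM t) dV)).
  move=> /is_derive_eq; apply; rewrite /y /GRing.scale/=.
  by field; apply/andP.
- move=> t /s2P[t1 st s1t].
  have t0 : 0 < t := lt_le_trans ltr01 t1.
  have tn : t != 0 by rewrite gt_eqF.
  have Kt : k <= K t by apply: K_le => //.
  have HR : rint a b (rho t) <= l * (c * t * d)
    + t ^+ 3 * (l ^+ 2 * c ^+ 2 / d) * e t + t ^+ 2 * (l * Ce + CE) * e t.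
    by apply: rho_bound => // z; have [] := far t z s1t.
  have HM := M_bound t0.
  have CC0 : 0 <= l * Ce + CE.
    have c0' := ltW c0; have l0' := ltW l0.
    by rewrite /Ce /CE -/l; repeat first [assumption | apply: addr_ge0
      | apply: mulr_ge0 | apply: exprn_ge0 | rewrite invr_ge0 ].
  have ct2 : 0 < c * t ^+ 2 by rewrite mulr_gt0// exprn_gt0.
  rewrite -(ler_pM2l ct2).
  have E1 : c * t ^+ 2 * (k / 2 / t) = c * t * k / 2 by field.
  have E2 : c * t ^+ 2 * (y t + C1 * t * e t) = c * t * K t - rint a b (rho t)
      - 2 * M t / t + t ^+ 3 * (l ^+ 2 * c ^+ 2 / d) * e t
      + t ^+ 3 * (l * Ce + CE) * e t + t ^+ 3 * c * (l ^+ 4 + 1) * e t.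
    rewrite (flux_identity t) /y /C1; field; rewrite tn cn gt_eqF//.
  have E3 : l * (c * t * d) = c * t * k / 2 by rewrite /d; field.
  have HMt : 2 * M t / t <= t * (c * (l ^+ 4 + 1) * e t).
    rewrite ler_pdivrMr//; apply: le_trans (ler_wpM2l (ler0n _ 2) HM) _.
    by rewrite le_eqVlt; apply/orP; left; apply/eqP; rewrite -/l; field.
  have t23 : t ^+ 2 * (l * Ce + CE) * e t <= t ^+ 3 * (l * Ce + CE) * e t.
    apply: ler_wpM2r; first exact: e_ge0.
    by apply: ler_wpM2r => //; rewrite ler_weXn2l.
  have t13 : t * (c * (l ^+ 4 + 1) * e t) <= t ^+ 3 * c * (l ^+ 4 + 1) * e t.
    have -> : t ^+ 3 * c * (l ^+ 4 + 1) * e t = t ^+ 3 * (c * (l ^+ 4 + 1) * e t) by ring.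
    apply: ler_wpM2r; first by rewrite !mulr_ge0 ?addr_ge0 ?exprn_ge0// ltW.
    by rewrite -[leLHS]expr1 ler_weXn2l.
  have ctK : c * t * k <= c * t * K t by rewrite ler_wpM2l// mulr_ge0// ltW.
  rewrite E1 E2; rewrite E3 in HR.
  set X1 := t ^+ 3 * _ * e t in HR *.
  set X2 := t ^+ 2 * _ * e t in HR t23; set X3 := t ^+ 3 * _ * e t in t23 *.
  set X4 := t * _ in HMt t13; set X5 := t ^+ 3 * _ * _ * e t in t13 *.
  set X6 := c * t * K t in ctK *; set X7 := c * t * k in ctK HR *.
  set X8 := 2 * M t / t in HMt *; set X9 := rint _ _ _ in HR *.
  lra.
- move=> t /s2P[t1 st s1t].
  have t0 : 0 < t := lt_le_trans ltr01 t1.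
  have tn : t != 0 by rewrite gt_eqF.
  have HQ : Q t <= 2 * l.
    rewrite mulrC -(rint_cst _ (ltW ab)); apply: le_rint; [cont|cont|move=> z _].
    have [_ + _] := far t z s1t.
    have := sqr_ge0 (q t z - 2); lra.
  rewrite /Y lerD//.
  have ct2 : 0 < c * t ^+ 2 by rewrite mulr_gt0// exprn_gt0.
  rewrite -(ler_pM2l ct2) (_ : _ * (c^-1 * _) = M t); last by field; rewrite cn tn.
  apply: le_trans (M_bound t0) _.
  rewrite -/l (mulrC c) ler_pdivrMr// ler_peMr//; last by rewrite ler1n.
  by rewrite !mulr_ge0 ?addr_ge0 ?exprn_ge0// ltW.
- move=> t /s2P[t1 st s1t].
  have t0 : 0 <= t := le_trans ler01 t1.
  rewrite -[leLHS]subr0 -K0.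
  have ce : continuous (fun s : R => c * s * e s) by cont.
  rewrite -(rint_FTC t0 ce dK).
  rewrite (@eq_rint _ _ _ _ (fun s => c * (s * e s))); last by move=> x; ring.
  rewrite rintZ; last by cont.
  by apply: ler_wpM2l; [exact: ltW|exact: HD].
Qed.

(** K is nondecreasing from K 0 = 0 and never positive, hence constant, and its
    derivative c s e vanishes. *)
Lemma ray_energy_eq0 s z : 0 < s -> a < z < b -> E s z = 0.
Proof.
move=> s0 zab.
have Kz t : 0 <= t -> K t = 0.
  by move=> t0; apply/eqP; rewrite eq_le flux_le0//= -K0 K_le.
have K's : 'D_1 K s = 0.
  rewrite (@near_eq_derive _ _ _ K (cst 0)); first by rewrite derive_cst.
  near=> t; rewrite Kz//; apply: ltW.
  suff : t \in `]0, s + 1[ by rewrite in_itv/= => /andP[].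
  by near: t; apply: near_in_itvoo; rewrite in_itv/= s0 ltrDl ltr01.
have es : e s = 0.
  have [_] := dK s; rewrite K's => /esym/eqP; rewrite mulf_eq0 mulf_eq0.
  by rewrite (gt_eqF s0) (gt_eqF (lt_le_trans ltr01 c1)) => /eqP.
have cEs : continuous (E s) by exact: sec.
exact: rint_eq0 cEs (E0 s) es zab.
Unshelve. all: by end_near. Qed.

End RayEnergy.

(** * A half-plane of finite energy *)

Section Caratheodory.
Variable R : realType.

(** The largest multiple of 1 / (n + 1) below s. *)
Let grid (n : nat) (s : R) : R := (Num.floor (s * n.+1%:R))%:~R / n.+1%:R.

Let grid_cvg s : grid n s @[n --> \oo] --> s.
Proof.
apply: (@squeeze_cvgr _ _ _ _ (fun n : nat => s - n.+1%:R^-1) (fun=> s)); last exact: cvg_cst.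
  near=> n; have n0 : 0 < n.+1%:R :> R by rewrite ltr0n.
  have := floor_itv (s * n.+1%:R) => /andP[h1 h2].
  apply/andP; split; last by rewrite /grid ler_pdivrMr.
  rewrite /grid -(ler_pM2r n0) mulrBl divfK ?mulVf ?gt_eqF//.
  by move: h2; rewrite intrD; lra.
rewrite -[X in _ --> X]subr0; apply: cvgB; [exact: cvg_cst|exact: cvg_harmonic].
Unshelve. all: by end_near. Qed.

(** f is the pointwise limit of the functions f(t, grid n s), which are constant
    in s on countably many intervals and measurable in t.  Continuity on
    a product of lines thus gives measurability for the product sigma-algebra. *)
Lemma measurable_caratheodory d (T : measurableType d) (f : T -> R -> R) :
  (forall t, continuous (f t)) ->
  (forall s, measurable_fun setT (f ^~ s)) ->
  measurable_fun setT (fun x : T * R => f x.1 x.2).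
Proof.
move=> cf mf.
apply: (@measurable_fun_cvg _ _ _ _ (fun n (x : T * R) => f x.1 (grid n x.2))).
  move=> n _ B mB; rewrite setTI.
  pose F (k : int) : set (T * R) :=
    ((f ^~ (k%:~R / n.+1%:R)) @^-1` B) `*` `[k%:~R / n.+1%:R, (k + 1)%:~R / n.+1%:R[.
  have mF k : measurable (F k).
    apply: measurableX => //; rewrite -[X in measurable X]setTI; exact: mf.
  have n0 : 0 < n.+1%:R :> R by rewrite ltr0n.
  (* integers are enumerated as k and - k for k natural *)
  have -> : (fun x : T * R => f x.1 (grid n x.2)) @^-1` B =
      \bigcup_(k : nat) (F k%:Z `|` F (- k%:Z)).
    apply/seteqP; split => [[t s] /= Bst|[t s] [k _]].
      have [k kE] : exists k : nat, Num.floor (s * n.+1%:R) = k%:Z \/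
          Num.floor (s * n.+1%:R) = - k%:Z.
        exists `|Num.floor (s * n.+1%:R)|%N.
        by have [h|/ltW h] := leP 0 (Num.floor (s * n.+1%:R));
          [left; rewrite gez0_abs|right; rewrite lez0_abs ?opprK].
      exists k => //.
      suff : F (Num.floor (s * n.+1%:R)) (t, s) by move: kE => [->|->]; [left|right].
      split => //=; rewrite in_itv/= ler_pdivrMr// ltr_pdivlMr//.
      exact: floor_itv.
    have FB (j : int) : F j (t, s) -> B (f t (grid n s)).
      move=> [/= Bj]; rewrite in_itv/= ler_pdivrMr// ltr_pdivlMr// => h.
      by rewrite /grid (floor_def h).
    by move=> [/FB|/FB].
  by apply: bigcupT_measurable => k; exact: measurableU.
move=> [t s] _ /=.
apply: (@cvg_comp _ _ _ (fun n => grid n s) (f t) _ (nbhs s)); first exact: grid_cvg.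
exact: cf.
Qed.

End Caratheodory.

Section TonelliOnSets.
Local Open Scope ereal_scope.
Context d1 d2 (T1 : measurableType d1) (T2 : measurableType d2) (R : realType).
Context (m1 : {sigma_finite_measure set T1 -> \bar R}) (m2 : {sigma_finite_measure set T2 -> \bar R}).

Lemma tonelli_on (A : set T1) (B : set T2) (f : T1 -> T2 -> \bar R) :
  measurable A -> measurable B ->
  measurable_fun setT (fun x : T1 * T2 => f x.1 x.2) ->
  (forall x y, 0 <= f x y) ->
  \int[m1]_(x in A) \int[m2]_(y in B) f x y =
  \int[m2]_(y in B) \int[m1]_(x in A) f x y.
Proof.
move=> mA mB mf f0.
pose g := (fun x : T1 * T2 => f x.1 x.2) \_ (A `*` B).
have mg : measurable_fun setT g.
  apply/(measurable_restrictT _ _).1; first exact: measurableX.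
  exact: measurable_funS mf.
have g0 x : 0 <= g x by rewrite /g patchE; case: ifP.
have := fubini_tonelli g mg g0 (m1 := m1) (m2 := m2).
have -> : \int[m1]_x \int[m2]_y g (x, y) = \int[m1]_(x in A) \int[m2]_(y in B) f x y.
  rewrite [RHS]integral_mkcond; apply: eq_integral => x _.
  rewrite patchE; case: ifPn => xA.
    rewrite [RHS]integral_mkcond; apply: eq_integral => y _.
    by rewrite /g !patchE in_setX xA.
  by rewrite integral0_eq// => y _; rewrite /g patchE in_setX (negbTE xA).
move=> ->.
rewrite [RHS]integral_mkcond; apply: eq_integral => y _.
rewrite patchE; case: ifPn => yB.
  rewrite [RHS]integral_mkcond; apply: eq_integral => x _.
  by rewrite /g !patchE in_setX yB andbT.
by rewrite integral0_eq// => x _; rewrite /g patchE in_setX (negbTE yB) andbF.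
Qed.

Lemma exists_lty (A : set T1) (f : T1 -> \bar R) :
  measurable A -> 0 < m1 A ->
  \int[m1]_(x in A) f x < +oo -> exists2 x, A x & f x < +oo.
Proof.
move=> mA A0 fA; apply: contrapT => nex.
have fE x : x \in A -> f x = cst +oo x.
  move=> xA; apply/eqP; rewrite -leye_eq leNgt; apply/negP => fx.
  by apply: nex; exists x => //; exact: set_mem.
by move: fA; rewrite (eq_integral _ _ fE) integral_cst// gt0_mulye// ltxx.
Qed.

End TonelliOnSets.

Lemma measurable_integral_on d1 d2 (T1 : measurableType d1) (T2 : measurableType d2)
    (R : realType) (m2 : {sigma_finite_measure set T2 -> \bar R})
    (B : set T2) (f : T1 -> T2 -> \bar R) :
  measurable B -> measurable_fun setT (fun x : T1 * T2 => f x.1 x.2) ->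
  (forall x y, 0 <= f x y)%E ->
  measurable_fun setT (fun x => \int[m2]_(y in B) f x y)%E.
Proof.
move=> mB mf f0.
pose g := (fun x : T1 * T2 => f x.1 x.2) \_ (setT `*` B).
have mg : measurable_fun setT g.
  apply/(measurable_restrictT _ _).1; first exact: measurableX.
  exact: measurable_funS mf.
have g0 x : (0 <= g x)%E by rewrite /g patchE; case: ifP.
have := measurable_fun_fubini_tonelli_F g mg g0 (m2 := m2).
congr (measurable_fun _ _); apply/funext => x.
rewrite /fubini_F [RHS]integral_mkcond; apply: eq_integral => y _.
by rewrite /g !patchE in_setX in_setT.
Qed.

Section RayOfFiniteEnergy.
Variable R : realType.
Notation mu := (@lebesgue_measure R).

Lemma vec3E (a b c : R) : vec3 a b c =
  a *: delta_mx 0 0 + b *: delta_mx 0 1 + c *: delta_mx 0 2.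
Proof.
apply/rowP => j; rewrite !mxE !eqxx/=.
by case: j => [[|[|[|//]]] ?]; rewrite /= ?mulr1 ?mulr0 ?addr0 ?add0r.
Qed.

Lemma cont_vec3 (T : topologicalType) (f g h : T -> R) :
  continuous f -> continuous g -> continuous h ->
  continuous (fun x => vec3 (f x) (g x) (h x)).
Proof.
move=> cf cg ch.
have -> : (fun x => vec3 (f x) (g x) (h x)) = (fun x => f x *: delta_mx 0 0
   + g x *: delta_mx 0 1 + h x *: delta_mx 0 2 : 'rV[R]_3).
  by apply/funext => x; exact: vec3E.
by move=> x; apply: cvgD; [apply: cvgD|]; apply: cvgZr_tmp; [exact: cf|exact: cg|exact: ch].
Qed.

Lemma cont_comp_vec3 (T : topologicalType) (F : 'rV[R]_3 -> R) (f g h : T -> R) :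
  continuous F -> continuous f -> continuous g -> continuous h ->
  continuous (fun x => F (vec3 (f x) (g x) (h x))).
Proof.
move=> cF cf cg ch x.
apply: (@continuous_comp _ _ _ (fun x => vec3 (f x) (g x) (h x)) F).
  exact: cont_vec3.
exact: cF.
Qed.

Lemma EFin_rint (a b : R) (f : R -> R) : continuous f ->
  (\int[mu]_(x in `[a, b]) (f x)%:E)%E = (rint a b f)%:E.
Proof.
move=> cf; rewrite /rint /Rintegral fineK//.
by apply: integrable_fin_num => //; exact: continuous_integrable.
Qed.

Lemma rint_scale (s : R) (f : R -> R) : 0 < s -> continuous f ->
  rint 0 s f = rint 0 1 (fun t => s * f (s * t)).
Proof.
move=> s0 cf.
have dF (t : R) : is_derive t 1 (fun t : R => s * t) s.
  have := is_deriveZ s (is_derive_id t (1 : R)).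
  by move=> /is_derive_eq; apply; exact: mulr1.
have F'E : (fun t : R => s * t)^`()%classic = cst s.
  by apply/funext => t; rewrite derive1E; have [_] := dF t.
have cs : continuous (fun t : R => s * t) by cont.
have cfs : continuous (fun t => f (s * t)).
  by move=> t; apply: (@continuous_comp _ _ _ (fun t => s * t) f); [exact: cs|exact: cf].
have sub : (\int[mu]_(x in `[(s * 0)%R, (s * 1)%R]) (f x)%:E =
    \int[mu]_(x in `[0%R, 1%R]) ((f (s * x) * s)%:E))%E.
  rewrite (@integration_by_substitution_increasing R (fun t => s * t)) ?F'E//.
  - by move=> x y _ _ xy; rewrite ltr_pM2l.
  - by move=> x _; exact: cvg_cst.
  - exact: is_cvg_cst.
  - exact: is_cvg_cst.
  - split; first by move=> x _; have [] := dF x.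
      by apply: cvg_at_right_filter; exact: cs.
    by apply: cvg_at_left_filter; exact: cs.
  - exact: continuous_subspaceT.
move: sub; rewrite mulr0 mulr1 !EFin_rint//; last by apply: cont_mul => //; exact: cont_cst.
by case=> ->; apply: eq_rint => t; rewrite mulrC.
Qed.

Variables (a b : R) (g : 'rV[R]_3 -> R).
Hypothesis cg : continuous g.
Hypothesis g0 : forall x, 0 <= g x.

Let e x y := rint a b (fun z => g (vec3 x y z)).

Let e0 x y : 0 <= e x y. Proof. exact: rint_ge0. Qed.

Let ce1 y : continuous (e ^~ y).
Proof.
apply: (@cont_rint _ a b (fun x z => g (vec3 x y z))).
by apply: cont_comp_vec3 => //; [exact: cont_fst|exact: cont_cst|exact: cont_snd].
Qed.

Let ce2 x : continuous (e x).
Proof.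
apply: (@cont_rint _ a b (fun y z => g (vec3 x y z))).
by apply: cont_comp_vec3 => //; [exact: cont_cst|exact: cont_fst|exact: cont_snd].
Qed.

Let ce3 t : continuous (fun s => e s (s * t)).
Proof.
apply: (@cont_rint _ a b (fun s z => g (vec3 s (s * t) z))).
apply: cont_comp_vec3 => //; [exact: cont_fst| |exact: cont_snd].
by apply: cont_mul; [exact: cont_fst|exact: cont_cst].
Qed.

Let me : measurable_fun setT (fun x : R * R => e x.1 x.2).
Proof.
apply: (@measurable_caratheodory R _ _ e) => // s.
exact: continuous_measurable_fun.
Qed.

Let mg : measurable_fun setT (fun x : (R * R) * R => (g (vec3 x.1.2 x.2 x.1.1))%:E).
Proof.
apply/measurable_EFinP.
apply: (@measurable_caratheodory R _ _ (fun (zx : R * R) y => g (vec3 zx.2 y zx.1))).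
  by move=> y; apply: cont_comp_vec3 => //; [exact: cont_cst|exact: cont_id|exact: cont_cst].
move=> y; apply: (@measurable_caratheodory R _ _ (fun z x => g (vec3 x y z))).
  by move=> z; apply: cont_comp_vec3 => //; [exact: cont_id|exact: cont_cst|exact: cont_cst].
move=> x; apply: continuous_measurable_fun.
by apply: cont_comp_vec3 => //; [exact: cont_cst|exact: cont_cst|exact: cont_id].
Qed.

Let mg2 (F : R -> R -> R) : (forall x, continuous (F x)) -> (forall y, continuous (F ^~ y)) ->
  measurable_fun setT (fun x : R * R => (F x.1 x.2)%:E).
Proof.
move=> c1 c2; apply/measurable_EFinP; apply: (@measurable_caratheodory R _ _ F) => // s.
exact: continuous_measurable_fun.
Qed.

Let gE0 x y z : (0 <= (g (vec3 x y z))%:E)%E. Proof. by rewrite lee_fin. Qed.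

(** Integrating first over z: the energy becomes a function e of (x_0, x_1). *)
Let integral_plane :
  (\int[mu]_(z in `[a, b]) \int[mu \x mu]_y (g (vec3 y.1 y.2 z))%:E =
   \int[mu]_x \int[mu]_y (e x y)%:E)%E.
Proof.
transitivity (\int[mu]_(z in `[a, b]) \int[mu]_(x in setT) \int[mu]_(y in setT) (g (vec3 x y z))%:E)%E.
  apply: eq_integral => z _.
  have mgz : measurable_fun setT (fun y : R * R => (g (vec3 y.1 y.2 z))%:E).
    apply: (mg2 (F := fun x y => g (vec3 x y z))).
      by move=> x; apply: cont_comp_vec3 => //; [exact: cont_cst|exact: cont_id|exact: cont_cst].
    by move=> y; apply: cont_comp_vec3 => //; [exact: cont_id|exact: cont_cst|exact: cont_cst].
  have H := @fubini_tonelli1 _ _ _ _ R mu mu (fun y : R * R => (g (vec3 y.1 y.2 z))%:E) mgz (fun y => gE0 y.1 y.2 z).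
  exact: H.
pose I z x := (\int[mu]_(y in setT) (g (vec3 x y z))%:E)%E.
have mI : measurable_fun setT (fun x : R * R => I x.1 x.2).
  by apply: (@measurable_integral_on _ _ _ _ _ mu setT (fun (zx : R * R) y => (g (vec3 zx.2 y zx.1))%:E)).
have I0 z x : (0 <= I z x)%E by apply: integral_ge0.
rewrite (@tonelli_on _ _ _ _ R mu mu _ _ I _ _ mI I0)//.
apply: eq_integral => x _; rewrite /I.
have mh : measurable_fun setT (fun x0 : R * R => (g (vec3 x x0.2 x0.1))%:E).
  apply: (mg2 (F := fun z y => g (vec3 x y z))).
    by move=> z; apply: cont_comp_vec3 => //; [exact: cont_cst|exact: cont_id|exact: cont_cst].
  by move=> y; apply: cont_comp_vec3 => //; [exact: cont_cst|exact: cont_cst|exact: cont_id].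
rewrite (@tonelli_on _ _ _ _ R mu mu _ _ (fun z y => (g (vec3 x y z))%:E) _ _ mh)//.
apply: eq_integral => y _; rewrite EFin_rint//.
by apply: cont_comp_vec3 => //; [exact: cont_cst|exact: cont_cst|exact: cont_id].
Qed.

(** The energy density in the coordinates x_0 = x, x_1 = t x; the absolute value
    makes it nonnegative on the whole plane, where measurability is stated. *)
Let k (x t : R) : \bar R := (`|x| * e x (x * t))%:E.

Let mk : measurable_fun setT (fun x : R * R => k x.1 x.2).
Proof.
apply/measurable_EFinP; apply: measurable_funM.
  by apply: measurableT_comp => //; exact: measurable_fst.
apply: (@measurableT_comp _ _ _ _ _ _ (fun x : R * R => e x.1 x.2) _
  (fun x : R * R => (x.1, x.1 * x.2))) => //.
apply/measurable_fun_pairP; split; first exact: measurable_fst.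
by apply: measurable_funM; [exact: measurable_fst|exact: measurable_snd].
Qed.

Let k0 x t : (0 <= k x t)%E. Proof. by rewrite lee_fin mulr_ge0. Qed.

(** The left-hand side is the integral of the energy over the sector
    0 <= x_1 <= x_0 in the coordinates (x_0, t) with x_1 = t x_0; the Jacobian is
    x_0.  The bounded range of t keeps the change of variables one-dimensional:
    for fixed x_0 it is a scaling of a segment. *)
Let sector_le :
  (\int[mu]_(x in `]0%R, +oo[) \int[mu]_(t in `[0%R, 1%R]) k x t <=
   \int[mu]_x \int[mu]_y (e x y)%:E)%E.
Proof.
have mee : measurable_fun setT (fun x => \int[mu]_y (e x y)%:E)%E.
  apply: (@measurable_integral_on _ _ _ _ _ mu setT (fun x y => (e x y)%:E)) => //.
    exact/measurable_EFinP.
have ee0 x : (0 <= \int[mu]_y (e x y)%:E)%E.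
  by apply: integral_ge0 => y _; rewrite lee_fin.
apply: (@le_trans _ _ (\int[mu]_(x in `]0%R, +oo[) \int[mu]_y (e x y)%:E)%E); last first.
  by apply: ge0_subset_integral.
apply: ge0_le_integral => //.
- by move=> x _; apply: integral_ge0.
- apply: measurable_funS (@measurable_integral_on _ _ _ _ _ mu _ k _ mk k0) => //.
- by apply: measurable_funS mee.
- move=> x /=; rewrite in_itv/= andbT => x0.
  rewrite EFin_rint; last first.
    apply: cont_mul; first exact: cont_cst.
    move=> t; apply: (@continuous_comp _ _ _ (fun t => x * t) (e x)); last exact: ce2.
    by apply: cvgM; [exact: cvg_cst|exact: cvg_id].
  rewrite gtr0_norm// -rint_scale// -EFin_rint//.
  apply: ge0_subset_integral => //.
    by apply/measurable_EFinP; exact: continuous_measurable_fun.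
  by move=> y _; rewrite lee_fin.
Qed.

(** Slicing the sector by rays and exchanging the integrals, the energy carried by
    the ray of slope t is integrable in t over [0, 1], so it is finite for some
    t. *)
Lemma finite_energy_ray :
  (\int[mu]_(z in `[a, b]) \int[mu \x mu]_y (g (vec3 y.1 y.2 z))%:E < +oo)%E ->
  exists2 t, 0 <= t <= 1 & exists D, forall S, 0 <= S ->
    rint 0 S (fun s => s * rint a b (fun z => g (vec3 s (s * t) z))) <= D.
Proof.
rewrite integral_plane => fin.
have := le_lt_trans sector_le fin.
rewrite (@tonelli_on _ _ _ _ R mu mu _ _ k _ _ mk k0)// => fin_t.
have I01 : (0 < mu `[0%R, 1%R])%E.
  by have /= -> := lebesgue_measure_itv `[0%R : R, 1%R]; rewrite lte_fin ltr01 oppr0 adde0 lte_fin.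
have [t t01 fint] := @exists_lty _ _ R mu _ _ (measurable_itv `[0%R : R, 1%R]) I01 fin_t.
exists t; first by move: t01; rewrite /= in_itv.
exists (fine (\int[mu]_(x in `]0%R, +oo[) k x t)%E) => S S0.
have cse : continuous (fun s : R => s * e s (s * t)).
  by apply: cont_mul; [exact: cont_id|exact: ce3].
rewrite -lee_fin [leRHS]fineK; last first.
  have kge0 : (0 <= \int[mu]_(x in `]0%R, +oo[) k x t)%E.
    by apply: integral_ge0 => x _; exact: k0.
  by rewrite (ge0_fin_numE kge0).
have -> : (rint 0 S (fun s : R => s * e s (s * t)))%:E = (\int[mu]_(x in `]0%R, S]) k x t)%E.
  rewrite -EFin_rint//.
  have mse : measurable_fun `]0%R, S] (fun s : R => (s * e s (s * t))%:E).
    by apply/measurable_EFinP; apply: measurable_funTS; exact: continuous_measurable_fun.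
  rewrite -(integral_itv_obnd_cbnd mse); apply: eq_integral => x.
  by rewrite inE/= in_itv/= => /andP[x0 _]; rewrite /k gtr0_norm.
apply: ge0_subset_integral => //.
- have ck : continuous (fun s : R => `|s| * e s (s * t)).
    by apply: cont_mul; [by apply: cont_norm; exact: cont_id|exact: ce3].
  by apply/measurable_EFinP; apply: measurable_funTS; exact: continuous_measurable_fun.
- by move=> x /=; rewrite !in_itv/= => /andP[-> _].
Qed.

End RayOfFiniteEnergy.

(** * Axial symmetry as an infinitesimal rotation *)

Section Rotations.
Variable R : realType.
Notation R3 := 'rV[R]_3.
Implicit Types (f : R3 -> R) (x : R3) (a b c s t z : R).

Lemma sum3 (V : nmodType) (F : 'I_3 -> V) : \sum_(i < 3) F i = F 0 + F 1 + F 2.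
Proof.
rewrite !big_ord_recl big_ord0 addr0 addrA.
by congr (_ + F _ + F _); apply/val_inj.
Qed.

Lemma forall_I3 (P : 'I_3 -> Prop) : P 0 -> P 1 -> P 2 -> forall i, P i.
Proof.
move=> P0 P1 P2 [[|[|[|//]]] i].
- by rewrite (_ : Ordinal i = 0)//; apply/val_inj.
- by rewrite (_ : Ordinal i = 1)//; apply/val_inj.
- by rewrite (_ : Ordinal i = 2)//; apply/val_inj.
Qed.

Lemma vec3_0 a b c : vec3 a b c 0 0 = a. Proof. by rewrite mxE. Qed.
Lemma vec3_1 a b c : vec3 a b c 0 1 = b. Proof. by rewrite mxE. Qed.
Lemma vec3_2 a b c : vec3 a b c 0 2 = c. Proof. by rewrite mxE. Qed.

Lemma vec3_eta x : vec3 (x 0 0) (x 0 1) (x 0 2) = x.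
Proof. by apply/rowP; apply: forall_I3; rewrite mxE. Qed.

(** The derivative d/d theta along the rotations about the axis, written without
    polar coordinates and hence defined on the axis too. *)
Definition angular f x : R := x 0 0 * partial 1 f x - x 0 1 * partial 0 f x.

Lemma angular_axis f x : cyl_rad x = 0 -> angular f x = 0.
Proof.
move=> /eqP; rewrite sqrtr_eq0 /x1 /x2 => h.
have h0 := sqr_ge0 (x 0 0); have h1 := sqr_ge0 (x 0 1).
have /eqP : x 0 0 ^+ 2 = 0 by lra.
have /eqP : x 0 1 ^+ 2 = 0 by lra.
by rewrite !sqrf_eq0 /angular => /eqP -> /eqP ->; rewrite !mul0r subrr.
Qed.

Lemma is_derive_vec3 f (g h k : R -> R) (g' h' k' a : R) :
  differentiable f (vec3 (g a) (h a) (k a)) ->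
  is_derive a 1 g g' -> is_derive a 1 h h' -> is_derive a 1 k k' ->
  is_derive a 1 (fun a => f (vec3 (g a) (h a) (k a)))
    (g' * partial 0 f (vec3 (g a) (h a) (k a)) +
     h' * partial 1 f (vec3 (g a) (h a) (k a)) +
     k' * partial 2 f (vec3 (g a) (h a) (k a))).
Proof.
move=> df dg dh dk.
have := @is_derive_curve _ _ f (fun a => vec3 (g a) (h a) (k a)) (vec3 g' h' k') a df.
rewrite sum3 vec3_0 vec3_1 vec3_2; apply; apply: forall_I3.
- by under eq_fun do rewrite vec3_0; rewrite vec3_0.
- by under eq_fun do rewrite vec3_1; rewrite vec3_1.
- by under eq_fun do rewrite vec3_2; rewrite vec3_2.
Qed.

Definition rotate a x : R3 := vec3 (cos a * x 0 0 - sin a * x 0 1)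
  (sin a * x 0 0 + cos a * x 0 1) (x 0 2).

Lemma cyl_rad_rotate a x : cyl_rad (rotate a x) = cyl_rad x.
Proof.
rewrite /cyl_rad /x1 /x2 /rotate vec3_0 vec3_1; congr Num.sqrt.
have := cos2Dsin2 a => h.
transitivity ((cos a ^+ 2 + sin a ^+ 2) * (x 0 0 ^+ 2 + x 0 1 ^+ 2)); first by ring.
by rewrite h mul1r.
Qed.

Lemma rotate0 x : rotate 0 x = x.
Proof.
by rewrite /rotate cos0 sin0 !mul1r !mul0r subr0 add0r vec3_eta.
Qed.

Lemma is_derive_rotl (k l : R) :
  is_derive (0 : R) 1 (fun a => cos a * k - sin a * l) (- l).
Proof.
have := is_deriveB (is_deriveM (is_derive_cos (0 : R)) (is_derive_cst k (0 : R) 1))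
  (is_deriveM (is_derive_sin (0 : R)) (is_derive_cst l (0 : R) 1)).
by move=> /is_derive_eq; apply; rewrite /GRing.scale/= sin0 cos0; ring.
Qed.

Lemma is_derive_rotr (k l : R) :
  is_derive (0 : R) 1 (fun a => sin a * k + cos a * l) k.
Proof.
have := is_deriveD (is_deriveM (is_derive_sin (0 : R)) (is_derive_cst k (0 : R) 1))
  (is_deriveM (is_derive_cos (0 : R)) (is_derive_cst l (0 : R) 1)).
by move=> /is_derive_eq; apply; rewrite /GRing.scale/= sin0 cos0; ring.
Qed.

Lemma is_derive_rotate f x : C1 f ->
  is_derive (0 : R) 1 (fun a => f (rotate a x)) (angular f x).
Proof.
move=> cf.
have df : differentiable f (vec3 (cos (0:R) * x 0 0 - sin 0 * x 0 1)
    (sin 0 * x 0 0 + cos 0 * x 0 1) (x 0 2)) by have [+ _] := cf; exact.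
have := @is_derive_vec3 f (fun a => cos a * x 0 0 - sin a * x 0 1)
  (fun a => sin a * x 0 0 + cos a * x 0 1) (fun=> x 0 2) _ _ _ 0 df
  (is_derive_rotl _ _) (is_derive_rotr _ _) (is_derive_cst (x 0 2) (0 : R) 1).
move=> /is_derive_eq; apply.
by rewrite -/(rotate 0 x) rotate0 /angular; ring.
Qed.

Lemma is_derive_unique (f : R -> R) (x d d' : R) :
  is_derive x 1 f d -> is_derive x 1 f d' -> d = d'.
Proof. by move=> [_ <-] [_ <-]. Qed.

Lemma angular_invariant f x : C1 f -> (forall a, f (rotate a x) = f x) ->
  angular f x = 0.
Proof.
move=> cf fx; apply: (is_derive_unique (is_derive_rotate x cf)).
by under eq_fun do rewrite fx; exact: is_derive_cst.
Qed.

Lemma axisym_function_angular (p : R3 -> R) : C1 p -> axisymmetric_function p ->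
  forall x, angular p x = 0.
Proof.
move=> cp [P pE] x.
have := sqrtr_ge0 (x1 x ^+ 2 + x2 x ^+ 2); rewrite -/(cyl_rad x) le_eqVlt.
move=> /predU1P[r0|r0]; first exact/angular_axis.
apply: angular_invariant => // a.
by rewrite !pE ?cyl_rad_rotate//; congr (P _ _); rewrite /xz vec3_2.
Qed.

Section Field.
Variable u : R3 -> R3.
Hypothesis u_c1 : forall j, C1 (fun x => u x 0 j).
Hypothesis u_axi : axisymmetric_field u.

Let cyl_rad_ge0 x : 0 <= cyl_rad x. Proof. exact: sqrtr_ge0. Qed.

(** The components along e_r, e_theta, e_z are rotation invariant, and the frame
    itself rotates. *)
Lemma axisym_rotate x a : 0 < cyl_rad x ->
  [/\ u (rotate a x) 0 0 = cos a * u x 0 0 - sin a * u x 0 1,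
      u (rotate a x) 0 1 = sin a * u x 0 0 + cos a * u x 0 1 &
      u (rotate a x) 0 2 = u x 0 2].
Proof.
move=> r0; have [ur [ut [uz uE]]] := u_axi.
have xzE : xz (rotate a x) = xz x by rewrite /xz vec3_2.
have := uE x r0; have := uE (rotate a x).
rewrite cyl_rad_rotate xzE => /(_ r0) -> ->.
set r := cyl_rad x; set vr := ur _ _; set vt := ut _ _; set vz := uz _ _.
have rn : r != 0 by rewrite gt_eqF.
rewrite !mxE/= cyl_rad_rotate -/r /x1 /x2 /rotate !vec3_0 !vec3_1.
by split; field.
Qed.

Let angular_off_axis x : 0 < cyl_rad x ->
  [/\ angular (fun x => u x 0 0) x = - u x 0 1,
      angular (fun x => u x 0 1) x = u x 0 0 &
      angular (fun x => u x 0 2) x = 0].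
Proof.
move=> r0.
split.
- apply: (is_derive_unique (is_derive_rotate x (u_c1 0))).
  rewrite (_ : (fun a => _) = (fun a => cos a * u x 0 0 - sin a * u x 0 1)).
    exact: is_derive_rotl.
  by apply/funext => a; have [] := axisym_rotate a r0.
- apply: (is_derive_unique (is_derive_rotate x (u_c1 1))).
  rewrite (_ : (fun a => _) = (fun a => sin a * u x 0 0 + cos a * u x 0 1)).
    exact: is_derive_rotr.
  by apply/funext => a; have [] := axisym_rotate a r0.
- apply: angular_invariant => // a.
  by have [] := axisym_rotate a r0.
Qed.

(** Points of the axis are approached along the first coordinate. *)
Let rad_shift x s : cyl_rad x = 0 -> 0 < s -> 0 < cyl_rad (vec3 (x 0 0 + s) (x 0 1) (x 0 2)).
Proof.
move=> /eqP; rewrite sqrtr_eq0 /x1 /x2 => h s0.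
have h0 := sqr_ge0 (x 0 0); have h1 := sqr_ge0 (x 0 1).
have /eqP : x 0 0 ^+ 2 = 0 by lra.
rewrite sqrf_eq0 => /eqP ->; rewrite add0r sqrtr_gt0 /x1 /x2 vec3_0 vec3_1.
by rewrite ltr_pwDl// exprn_gt0.
Qed.

Let cont_shift f x : continuous f ->
  continuous (fun s => f (vec3 (x 0 0 + s) (x 0 1) (x 0 2))).
Proof.
move=> cf.
apply: (@cont_comp_vec3 _ _ f (fun s => x 0 0 + s) (fun=> x 0 1) (fun=> x 0 2)) => //;
  cont.
Qed.

Let axis_zero x f : continuous f -> cyl_rad x = 0 ->
  (forall y, 0 < cyl_rad y -> f y = 0) -> f x = 0.
Proof.
move=> cf r0 fy.
have := continuous_eq0 (@cont_shift f x cf); rewrite addr0 vec3_eta; apply.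
by move=> s /andP[s0 _]; exact/fy/rad_shift.
Qed.

Let angular_cont f : C1 f -> continuous (angular f).
Proof.
move=> [_ cf]; apply: cont_add; [|apply: cont_opp]; apply: cont_mul => //;
  exact: coord_continuous.
Qed.

(** Axial symmetry is only given off the axis.  There u_0 = angular(u_1); the
    right-hand side is continuous and vanishes on the axis, so u_0 vanishes on
    the axis as well. *)
Lemma axisym_axis x : cyl_rad x = 0 -> u x 0 0 = 0 /\ u x 0 1 = 0.
Proof.
move=> r0; split.
- have := @axis_zero x (fun x => angular (fun x => u x 0 1) x - u x 0 0) _ r0.
  rewrite angular_axis// sub0r => h; apply/eqP; rewrite -oppr_eq0; apply/eqP/h.
    by apply: cont_add; [exact: angular_cont|exact/cont_opp/c1_cont].
  by move=> y y0; have [_ -> _] := angular_off_axis y0; rewrite subrr.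
- have := @axis_zero x (fun x => angular (fun x => u x 0 0) x + u x 0 1) _ r0.
  rewrite angular_axis// add0r; apply.
    by apply: cont_add; [exact: angular_cont|exact/c1_cont].
  by move=> y y0; have [-> _ _] := angular_off_axis y0; rewrite addNr.
Qed.

Lemma axisym_field_angular x :
  [/\ angular (fun x => u x 0 0) x = - u x 0 1,
      angular (fun x => u x 0 1) x = u x 0 0 &
      angular (fun x => u x 0 2) x = 0].
Proof.
have := cyl_rad_ge0 x; rewrite le_eqVlt => /predU1P[/esym r0|/angular_off_axis//].
have [u0 u1] := axisym_axis r0.
by rewrite !angular_axis// u0 u1 oppr0.
Qed.

(** Off the axis |u|^2 is a function of (r, z), because e_r, e_theta, e_z form
    an orthonormal frame. *)
Lemma axisym_zero x y : cyl_rad x = cyl_rad y -> x 0 2 = y 0 2 -> 0 < cyl_rad x ->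
  u x = 0 -> u y = 0.
Proof.
move=> rxy zxy r0 ux0; have [ur [ut [uz uE]]] := u_axi.
have key w : 0 < cyl_rad w -> u w 0 0 ^+ 2 + u w 0 1 ^+ 2 + u w 0 2 ^+ 2 =
    ur (cyl_rad w) (w 0 2) ^+ 2 + ut (cyl_rad w) (w 0 2) ^+ 2 + uz (cyl_rad w) (w 0 2) ^+ 2.
  move=> w0; rewrite uE// !mxE/= /xz.
  have rE : x1 w ^+ 2 + x2 w ^+ 2 = cyl_rad w ^+ 2.
    by rewrite sqr_sqrtr// addr_ge0// sqr_ge0.
  have rn : cyl_rad w != 0 by rewrite gt_eqF.
  set r := cyl_rad w in rE rn *; set A := ur _ _; set B := ut _ _; set C := uz _ _.
  transitivity ((A ^+ 2 + B ^+ 2) * ((x1 w ^+ 2 + x2 w ^+ 2) / r ^+ 2) + C ^+ 2).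
    by field.
  by rewrite rE divff ?mulr1// sqrf_eq0.
have := key y; rewrite -rxy -zxy => /(_ r0); rewrite -key// ux0 !mxE expr0n/= !addr0.
have h0 := sqr_ge0 (u y 0 0); have h1 := sqr_ge0 (u y 0 1); have h2 := sqr_ge0 (u y 0 2).
move=> h; apply/rowP; apply: forall_I3; rewrite mxE; apply/eqP; rewrite -sqrf_eq0; apply/eqP; lra.
Qed.

Lemma axis_closure : (forall y, 0 < cyl_rad y -> u y = 0) -> forall x, u x = 0.
Proof.
move=> uy x.
have := cyl_rad_ge0 x; rewrite le_eqVlt => /predU1P[/esym r0|/uy//].
apply/rowP => j; rewrite mxE; apply: (axis_zero (f := fun x => u x 0 j)) => //.
  exact: c1_cont.
by move=> y y0; rewrite uy// mxE.
Qed.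

End Field.
End Rotations.

(** * The equations in cylindrical form *)

(** Derivatives of expressions are themselves large terms; replaced by variables,
    they leave polynomial identities in a commutative ring. *)
Ltac atoms := repeat match goal with
  |- context [@partial ?R ?n ?V ?i ?f ?x] =>
    let d := fresh "D" in generalize (@partial R n V i f x) => d
  end.

Section Components.
Variables (R : realType) (u : 'rV[R]_3 -> 'rV[R]_3) (p : 'rV[R]_3 -> R).
Notation R3 := 'rV[R]_3.
Hypothesis su : smooth u.
Hypothesis sp : smooth p.

Definition component j : R3 -> R := fun x => u x 0 j.

Lemma comp_smooth j : smooth (component j). Proof. exact: smooth_entry. Qed.

Lemma comp_c1 j : C1 (component j). Proof. exact/smooth_c1/comp_smooth. Qed.

Lemma dcomp_c1 i j : C1 (partial i (component j)).
Proof. exact/smooth_c1/smooth_partial/comp_smooth. Qed.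

Lemma partialE i j x : partial i u x 0 j = partial i (component j) x.
Proof. exact: (partial_entry j (proj2 (su [::]) i x)). Qed.

Lemma partial2E i j x : partial i (partial i u) x 0 j = partial i (partial i (component j)) x.
Proof.
rewrite (partial_entry j (proj2 (su [:: i]) i x)).
have -> : partial i (component j) = fun y => partial i u y 0 j.
  by apply/funext => y; rewrite partialE.
by [].
Qed.

Lemma grad_sqnormE x : grad_sqnorm u x =
  (partial 0 (component 0) x ^+ 2 + partial 0 (component 1) x ^+ 2 + partial 0 (component 2) x ^+ 2)
  + (partial 1 (component 0) x ^+ 2 + partial 1 (component 1) x ^+ 2 + partial 1 (component 2) x ^+ 2)
  + (partial 2 (component 0) x ^+ 2 + partial 2 (component 1) x ^+ 2 + partial 2 (component 2) x ^+ 2).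
Proof.
have -> : grad_sqnorm u x = \sum_(i < 3) \sum_(j < 3) partial i (component j) x ^+ 2.
  by apply: eq_bigr => i _; apply: eq_bigr => j _; rewrite partialE.
by apply: (etrans (sum3 _)); congr (_ + _ + _); exact: sum3.
Qed.

Lemma grad_comp_le j x : partial 0 (component j) x ^+ 2 + partial 1 (component j) x ^+ 2
  + partial 2 (component j) x ^+ 2 <= grad_sqnorm u x.
Proof.
have h i k : 0 <= partial i (component k) x ^+ 2 by exact: sqr_ge0.
rewrite grad_sqnormE.
move: (h 0 0) (h 0 1) (h 0 2) (h 1 0) (h 1 1) (h 1 2) (h 2 0) (h 2 1) (h 2 2).
by move: j; apply: forall_I3; atoms => *; lra.
Qed.

(** One entry of the vector equation A + G - H = 0, where A is the advection
    term, G the pressure gradient and H the Laplacian; stated on arbitrary vectors, it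
    is insensitive to how those are defined. *)
Let momentum_entry (a b c : R) (A B C D E F G H K : R3) j (B' C' D' E' F' G' K' : R) :
  A + G - H = 0 -> A = a *: B + b *: C + c *: D -> H = E + F + K ->
  B 0 j = B' -> C 0 j = C' -> D 0 j = D' -> E 0 j = E' -> F 0 j = F' ->
  K 0 j = K' -> G 0 j = G' ->
  a * B' + b * C' + c * D' + G' - (E' + F' + K') = 0.
Proof.
move=> h AE HE <- <- <- <- <- <- <-.
by move: h; rewrite AE HE => /rowP/(_ j); rewrite !mxE.
Qed.

Hypothesis ns : navier_stokes u p.

Lemma momentum_eq j x : component 0 x * partial 0 (component j) x + component 1 x * partial 1 (component j) x
  + component 2 x * partial 2 (component j) x + partial j p x
  - (partial 0 (partial 0 (component j)) x + partial 1 (partial 1 (component j)) x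
     + partial 2 (partial 2 (component j)) x) = 0.
Proof.
have [/(_ x) h _] := ns.
have A : advection u u x = component 0 x *: partial 0 u x + component 1 x *: partial 1 u x
  + component 2 x *: partial 2 u x by exact: sum3.
have L : laplacian u x = partial 0 (partial 0 u) x + partial 1 (partial 1 u) x
  + partial 2 (partial 2 u) x by exact: sum3.
apply: (momentum_entry h A L (partialE 0 j x) (partialE 1 j x) (partialE 2 j x)
  (partial2E 0 j x) (partial2E 1 j x) (partial2E 2 j x)).
by rewrite /gradient mxE.
Qed.

Lemma divergence_eq x : partial 0 (component 0) x + partial 1 (component 1) x + partial 2 (component 2) x = 0.
Proof.
have [_ /(_ x)] := ns; rewrite /divergence sum3 => h.
have E := congr2 +%R (congr2 +%R (partialE 0 0 x) (partialE 1 1 x)) (partialE 2 2 x).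
exact: (etrans (esym E) h).
Qed.

(** Half of |u|^2; products rather than squares match the product rule. *)
Definition kinetic : R3 -> R := fun x =>
  2^-1 * (component 0 x * component 0 x + component 1 x * component 1 x + component 2 x * component 2 x).

Lemma kinetic_c1 : C1 kinetic.
Proof.
apply: c1_mul; first exact: c1_cst.
by apply: c1_add; [apply: c1_add|]; apply: c1_mul; exact: comp_c1.
Qed.

Lemma partial_kinetic i : partial i kinetic = fun x =>
  component 0 x * partial i (component 0) x + component 1 x * partial i (component 1) x
  + component 2 x * partial i (component 2) x.
Proof.
apply/funext => x; have cc := comp_c1; have cm j := c1_mul (cc j) (cc j).
rewrite /kinetic partial_mul; [|exact: c1_cst|by apply: c1_add; [apply: c1_add|]].
rewrite partial_cst (partial_add i x (c1_add (cm 0) (cm 1)) (cm 2)).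
by rewrite (partial_add i x (cm 0) (cm 1)) !partial_mul//; atoms; field.
Qed.

Let partial_kineticE i x : partial i kinetic x =
  component 0 x * partial i (component 0) x + component 1 x * partial i (component 1) x
  + component 2 x * partial i (component 2) x.
Proof. by rewrite partial_kinetic. Qed.

Lemma dkinetic_c1 i : C1 (partial i kinetic).
Proof.
rewrite partial_kinetic.
by apply: c1_add; [apply: c1_add|]; apply: c1_mul; [exact: comp_c1|exact: dcomp_c1|
  exact: comp_c1|exact: dcomp_c1|exact: comp_c1|exact: dcomp_c1].
Qed.

Lemma partial2_kinetic i x : partial i (partial i kinetic) x =
  partial i (component 0) x ^+ 2 + component 0 x * partial i (partial i (component 0)) x
  + (partial i (component 1) x ^+ 2 + component 1 x * partial i (partial i (component 1)) x)
  + (partial i (component 2) x ^+ 2 + component 2 x * partial i (partial i (component 2)) x).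
Proof.
have cc := comp_c1; have cd := dcomp_c1 i; have cm j := c1_mul (cc j) (cd j).
rewrite partial_kinetic partial_add//; last exact: c1_add.
by rewrite partial_add// !partial_mul//; ring.
Qed.

(** Multiply the momentum equation by u: with Laplacian(q) = |grad u|^2 +
    u . Laplacian(u) and u . (u . grad) u = u . grad q, the sum over the
    components is the claim. *)
Lemma bernoulli x :
  partial 0 (partial 0 kinetic) x + partial 1 (partial 1 kinetic) x
  + partial 2 (partial 2 kinetic) x =
  grad_sqnorm u x
  + (component 0 x * (partial 0 kinetic x + partial 0 p x)
  + component 1 x * (partial 1 kinetic x + partial 1 p x)
  + component 2 x * (partial 2 kinetic x + partial 2 p x)).
Proof.
have h0 := momentum_eq 0 x; have h1 := momentum_eq 1 x; have h2 := momentum_eq 2 x.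
rewrite (partial2_kinetic 0) (partial2_kinetic 1) (partial2_kinetic 2).
rewrite grad_sqnormE (partial_kineticE 0 x) (partial_kineticE 1 x) (partial_kineticE 2 x).
move: h0 h1 h2.
atoms; generalize (component 0 x) (component 1 x) (component 2 x) => v0 v1 v2 h0 h1 h2.
apply/eqP; rewrite -subr_eq0; apply/eqP.
transitivity (- (v0 * 0 + v1 * 0 + v2 * 0) : R); last by ring.
by rewrite -[in v0 * 0]h0 -[in v1 * 0]h1 -[in v2 * 0]h2; ring.
Qed.

Hypothesis u_axi : axisymmetric_field u.
Hypothesis p_axi : axisymmetric_function p.

Lemma angular_comp x :
  [/\ angular (component 0) x = - component 1 x, angular (component 1) x = component 0 x &
      angular (component 2) x = 0].
Proof. exact: (axisym_field_angular comp_c1 u_axi). Qed.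

(** Rotation swaps u_0 and u_1 up to sign, and the two contributions to |u|^2
    cancel. *)
Lemma angular_kinetic x : angular kinetic x = 0.
Proof.
have [h0 h1 h2] := angular_comp x.
rewrite /angular (partial_kineticE 0 x) (partial_kineticE 1 x).
transitivity (component 0 x * angular (component 0) x + component 1 x * angular (component 1) x
  + component 2 x * angular (component 2) x); first by rewrite /angular; atoms; ring.
by rewrite h0 h1 h2; ring.
Qed.

Lemma angular_pressure x : angular p x = 0.
Proof. exact: (axisym_function_angular (smooth_c1 sp) p_axi). Qed.

End Components.

Section Rays.
Variables (R : realType) (t : R).
Notation R3 := 'rV[R]_3.
Implicit Types (f : R3 -> R) (s z : R).

Definition ray s z : R3 := vec3 s (s * t) z.

(** The derivative in the direction (1, t, 0) of the ray.  It is not normalized: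
    s is the first coordinate, not the arc length, whence the factor 1 + t^2
    in the identities below. *)
Definition radial f : R3 -> R := fun x => partial 0 f x + t * partial 1 f x.

Lemma is_derive_ray f s z : C1 f ->
  is_derive s 1 (fun s => f (ray s z)) (radial f (ray s z)).
Proof.
move=> cf.
have dst : is_derive s 1 (fun s : R => s * t) t.
  have := is_deriveM (is_derive_id s (1 : R)) (is_derive_cst t s 1).
  by move=> /is_derive_eq; apply; rewrite /GRing.scale/=; ring.
have df : differentiable f (vec3 s (s * t) z) by have [+ _] := cf; exact.
have := @is_derive_vec3 R f (fun s => s) (fun s => s * t) (fun=> z) _ _ _ s df
  (is_derive_id s (1 : R)) dst (is_derive_cst z s 1).
by move=> /is_derive_eq; apply; rewrite /radial /ray; atoms => *; ring.
Qed.

Lemma is_derive_vert f s z : C1 f ->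
  is_derive z 1 (fun z => f (ray s z)) (partial 2 f (ray s z)).
Proof.
move=> cf.
have df : differentiable f (vec3 s (s * t) z) by have [+ _] := cf; exact.
have := @is_derive_vec3 R f (fun=> s) (fun=> s * t) (fun z => z) _ _ _ z df
  (is_derive_cst s z 1) (is_derive_cst (s * t) z 1) (is_derive_id z (1 : R)).
by move=> /is_derive_eq; apply; rewrite /ray; atoms => *; ring.
Qed.

Lemma ray_cont f : continuous f -> continuous (fun x : R * R => f (ray x.1 x.2)).
Proof.
by move=> cf; apply: cont_comp_vec3 => //; [exact: cont_fst| |exact: cont_snd]; cont.
Qed.

Lemma radial_c1 f : C1 (partial 0 f) -> C1 (partial 1 f) -> C1 (radial f).
Proof. by move=> c0 c1'; exact: (c1_add c0 (c1_mul (@c1_cst R 3 t) c1')). Qed.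

Lemma radial_cont f : C1 f -> continuous (radial f).
Proof. by move=> [_ cf]; rewrite /radial; apply: cont_add => //; apply: cont_mul => //; exact: cont_cst. Qed.

Lemma ray_0 s z : ray s z 0 0 = s. Proof. exact: vec3_0. Qed.
Lemma ray_1 s z : ray s z 0 1 = s * t. Proof. exact: vec3_1. Qed.

(** In polar coordinates this is (1/r) d_r (r d_r f) = Laplacian(f) for f
    independent of the angle.  The derivatives in the directions 0 and 1 of
    angular(f) = 0 express mixed derivatives at a point of the ray by pure ones;
    t times the first minus the second gives the claim, each of d_0 d_1 f and
    d_1 d_0 f cancelling on its own. *)
Lemma ray_laplacian f s z : C1 (partial 0 f) -> C1 (partial 1 f) ->
  (forall x, angular f x = 0) ->
  radial f (ray s z) + s * radial (radial f) (ray s z) =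
  (1 + t ^+ 2) * s * (partial 0 (partial 0 f) (ray s z) + partial 1 (partial 1 f) (ray s z)).
Proof.
move=> c0 c1' ang; set x := ray s z.
have cx j : C1 (fun x : R3 => x 0 j) by exact: c1_coord.
have ang0 i : partial i (angular f) x = 0.
  by rewrite (_ : angular f = fun=> 0) ?partial_cst//; apply/funext.
have angE i : partial i (angular f) x =
    (i == 0)%:R * partial 1 f x + x 0 0 * partial i (partial 1 f) x
    - ((i == 1)%:R * partial 0 f x + x 0 1 * partial i (partial 0 f) x).
  have e0 := partial_mul i x (cx 0) c1'; have e1 := partial_mul i x (cx 1) c0.
  rewrite (partial_coord i 0) in e0; rewrite (partial_coord i 1) in e1.
  have e2 := partial_opp i x (c1_mul (cx 1) c0); rewrite e1 in e2.
  apply: (etrans (partial_add i x (c1_mul (cx 0) c1') (c1_opp (c1_mul (cx 1) c0)))).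
  by rewrite e0 e2.
have h0 := angE 0; have h1 := angE 1.
rewrite ang0 (_ : (0 == 0 :> 'I_3) = true)// (_ : (0 == 1 :> 'I_3) = false)// /x ray_0 ray_1 in h0.
rewrite ang0 (_ : (1 == 0 :> 'I_3) = false)// (_ : (1 == 1 :> 'I_3) = true)// /x ray_0 ray_1 in h1.
have rr i : partial i (radial f) x = partial i (partial 0 f) x + t * partial i (partial 1 f) x.
  have e1 := partial_mul i x (@c1_cst R 3 t) c1'.
  rewrite (partial_cst t i x) mul0r add0r in e1.
  apply: (etrans (partial_add i x c0 (c1_mul (@c1_cst R 3 t) c1'))).
  by rewrite e1.
have -> : radial (radial f) x = partial 0 (radial f) x + t * partial 1 (radial f) x by [].
have -> : radial f x = partial 0 f x + t * partial 1 f x by [].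
rewrite (rr 0) (rr 1); move: h0 h1; rewrite -/x mulr1n mulr0n.
atoms; rewrite !mul1r !mul0r !add0r => h0 h1.
apply/eqP; rewrite -subr_eq0; apply/eqP.
transitivity (t * 0 - 0 : R); last by ring.
by rewrite {1}h0 h1; ring.
Qed.

End Rays.

(** * Vanishing gradient on a half-plane *)

Section RayRigidity.
Variables (R : realType) (u : 'rV[R]_3 -> 'rV[R]_3) (p : 'rV[R]_3 -> R).
Notation R3 := 'rV[R]_3.
Hypothesis su : smooth u.
Hypothesis sp : smooth p.
Hypothesis u_per : z_periodic u.
Hypothesis p_per : z_periodic p.
Hypothesis u_axi : axisymmetric_field u.
Hypothesis p_axi : axisymmetric_function p.
Hypothesis ns : navier_stokes u p.
Hypothesis u_infty : u x @[x --> @infty_nbhs R] --> (0 : R3).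

Lemma small_at_infinity (e : R) : 0 < e ->
  exists M, forall x, M < cyl_rad x -> forall j, `|u x 0 j| < e.
Proof.
move=> e0; have /u_infty [M _ HM] : nbhs (0 : R3) [set y | `|y| < e].
  by apply/nbhs_ballP; exists e => //= y; rewrite -ball_normE/= sub0r normrN.
exists M => x /HM /= ux j; apply: le_lt_trans ux; exact: ler_mx_entry.
Qed.

Let cp : C1 p := smooth_c1 sp.
Let cu := comp_c1 su.
Let ck := kinetic_c1 su.

(** r times the radial velocity: polynomial in x and u, hence smooth across the
    axis. *)
Let radial_moment : R3 -> R := fun x => x 0 0 * component u 0 x + x 0 1 * component u 1 x.

Let cx (j : 'I_3) : C1 (fun x : R3 => x 0 j) := c1_coord R j.

Let moment_c1 : C1 radial_moment.
Proof. exact: (c1_add (c1_mul (cx 0) (cu 0)) (c1_mul (cx 1) (cu 1))). Qed.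

Let partial_moment i x : partial i radial_moment x =
  (i == 0)%:R * component u 0 x + x 0 0 * partial i (component u 0) x
  + ((i == 1)%:R * component u 1 x + x 0 1 * partial i (component u 1) x).
Proof.
have e0 := partial_mul i x (cx 0) (cu 0); have e1 := partial_mul i x (cx 1) (cu 1).
rewrite (partial_coord i 0) in e0; rewrite (partial_coord i 1) in e1.
apply: (etrans (partial_add i x (c1_mul (cx 0) (cu 0)) (c1_mul (cx 1) (cu 1)))).
by rewrite e0 e1.
Qed.

(** The axial component of the energy flux grad q - u (q + p). *)
Let axial_flux : R3 -> R := fun x =>
  partial 2 (kinetic u) x - component u 2 x * (kinetic u x + p x).

Let cP : C1 (fun x => kinetic u x + p x) := c1_add ck cp.

Let flux_c1 : C1 axial_flux.
Proof. exact: (c1_add (dkinetic_c1 su 2) (c1_opp (c1_mul (cu 2) cP))). Qed.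

Let partial_flux x : partial 2 axial_flux x = partial 2 (partial 2 (kinetic u)) x
  - (partial 2 (component u 2) x * (kinetic u x + p x)
     + component u 2 x * (partial 2 (kinetic u) x + partial 2 p x)).
Proof.
have e0 := partial_mul 2 x (cu 2) cP; rewrite (partial_add 2 x ck cp) in e0.
have e1 := partial_opp 2 x (c1_mul (cu 2) cP); rewrite e0 in e1.
apply: (etrans (partial_add 2 x (dkinetic_c1 su 2) (c1_opp (c1_mul (cu 2) cP)))).
by rewrite e1.
Qed.

Let per : R3 := vec3 0 0 (2 * pi).

Let flux_per x : axial_flux (x + per) = axial_flux x.
Proof.
have up j y : component u j (y + per) = component u j y by rewrite /component u_per.
have kp y : kinetic u (y + per) = kinetic u y by rewrite /kinetic !up.
by rewrite /axial_flux (partial_periodic 2 kp) up kp p_per.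
Qed.

Let ray_per t s : ray t s pi = ray t s (- pi) + per.
Proof.
apply/rowP; apply: forall_I3; rewrite !mxE/= ?addr0//; ring.
Qed.

Section OneRay.
Variable t : R.
Hypothesis t01 : 0 <= t <= 1.
Let c : R := 1 + t ^+ 2.
Let X := ray t.

(** The divergence-free condition d_r (r u_r) = - r d_z u_z.  The terms
    with u_0 and u_1 are recognized through their angular derivatives. *)
Lemma radial_moment_ray s z :
  radial t radial_moment (X s z) = - c * s * partial 2 (component u 2) (X s z).
Proof.
have [h0 h1 _] := angular_comp su u_axi (X s z).
have d := divergence_eq su ns (X s z).
rewrite /radial (partial_moment 0) (partial_moment 1) /X ray_0 ray_1.
rewrite (_ : (0 == 0 :> 'I_3) = true)// (_ : (0 == 1 :> 'I_3) = false)//.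
rewrite (_ : (1 == 0 :> 'I_3) = false)// (_ : (1 == 1 :> 'I_3) = true)//.
move: h0 h1 d; rewrite /angular /X ray_0 ray_1 /c mulr1n mulr0n.
atoms; generalize (component u 0 (ray t s z)) (component u 1 (ray t s z)).
move=> u0 u1 h0 h1 d; rewrite -h1.
have -> : u1 = - (- u1) by rewrite opprK.
rewrite -h0; move: d => /eqP; rewrite addrC addr_eq0 => /eqP ->; ring.
Qed.

(** For f independent of the angle, u . grad f has only the radial part
    u_r d_r f besides v d_z f. *)
Lemma transport_ray f s z : (forall x, angular f x = 0) ->
  radial_moment (X s z) * radial t f (X s z) =
  c * s * (component u 0 (X s z) * partial 0 f (X s z) + component u 1 (X s z) * partial 1 f (X s z)).
Proof.
move=> /(_ (X s z)); rewrite /radial_moment /radial /angular /X ray_0 ray_1 /c.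
atoms; generalize (component u 0 (ray t s z)) (component u 1 (ray t s z)) => u0 u1 h.
apply/eqP; rewrite -subr_eq0; apply/eqP.
transitivity ((t * u0 - u1) * 0 : R); last by rewrite mulr0.
by rewrite -h; ring.
Qed.

(** [ray_laplacian] for f = v, with the planar Laplacian taken from the axial
    momentum equation. *)
Let momentum_ray (s z : R) :
  is_derive s 1 (fun s => s * radial t (component u 2) (X s z))
    (radial_moment (X s z) * radial t (component u 2) (X s z)
     + c * s * (component u 2 (X s z) * partial 2 (component u 2) (X s z)
        + partial 2 p (X s z) - partial 2 (partial 2 (component u 2)) (X s z))).
Proof.
have a2 x : angular (component u 2) x = 0 by have [] := angular_comp su u_axi x.
have c0 := dcomp_c1 su 0 2; have c1' := dcomp_c1 su 1 2.
have := is_deriveM (is_derive_id s (1 : R)) (is_derive_ray t s z (radial_c1 t c0 c1')).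
move=> /is_derive_eq; apply; rewrite /GRing.scale/=.
have L := ray_laplacian t s z c0 c1' a2.
have T := transport_ray s z a2.
have N := momentum_eq su ns 2 (X s z).
rewrite mulr1 addrC L T -/c -/X; move: N.
atoms; generalize (component u 0 (X s z)) (component u 1 (X s z)) (component u 2 (X s z)).
move=> u0 u1 u2 N; apply/eqP; rewrite -subr_eq0; apply/eqP.
transitivity (- (c * s) * 0 : R); last by rewrite mulr0.
by rewrite -N; ring.
Qed.

(** [ray_laplacian] for f = q, with the planar Laplacian taken from [bernoulli];
    the divergence-free condition puts the transport term u . grad (q + p) in
    divergence form. *)
Let energy_ray (s z : R) :
  is_derive s 1 (fun s => s * radial t (kinetic u) (X s z)
      - radial_moment (X s z) * (kinetic u (X s z) + p (X s z)))
    (c * s * (grad_sqnorm u (X s z) - partial 2 axial_flux (X s z))).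
Proof.
have ak := angular_kinetic su u_axi; have ap := angular_pressure sp p_axi.
have c0 := dkinetic_c1 su 0; have c1' := dkinetic_c1 su 1.
have := is_deriveB
  (is_deriveM (is_derive_id s (1 : R)) (is_derive_ray t s z (radial_c1 t c0 c1')))
  (is_deriveM (is_derive_ray t s z moment_c1)
    (is_deriveD (is_derive_ray t s z ck) (is_derive_ray t s z cp))).
move=> /is_derive_eq; apply; rewrite /GRing.scale/=.
have L := ray_laplacian t s z c0 c1' ak.
have Tk := transport_ray s z ak; have Tp := transport_ray s z ap.
have B := bernoulli su ns (X s z).
have -> : s * radial t (radial t (kinetic u)) (X s z) =
  (1 + t ^+ 2) * s * (partial 0 (partial 0 (kinetic u)) (X s z) +
    partial 1 (partial 1 (kinetic u)) (X s z)) - radial t (kinetic u) (X s z).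
  by rewrite -L addrC addKr.
rewrite ?fctE (radial_moment_ray s z) (partial_flux (X s z)).
have EE := canRL (addrK _) (esym B); rewrite EE.
move: Tk Tp; rewrite -/X -/c; atoms; generalize (radial_moment (X s z)) (radial t p (X s z)); generalize (component u 0 (X s z)) (component u 1 (X s z)) (component u 2 (X s z))
  (radial t (kinetic u) (X s z)) (kinetic u (X s z)) (p (X s z)).
move=> u0 u1 u2 Dk k q m Dp /eqP; rewrite -subr_eq0 => /eqP Tk /eqP.
rewrite -subr_eq0 => /eqP Tp; apply/eqP; rewrite -subr_eq0; apply/eqP.
transitivity (- 0 - 0 : R); last by rewrite oppr0 addr0.
by rewrite -{1}Tk -Tp; ring.
Qed.

Let c_ge1 : 1 <= c. Proof. by rewrite /c lerDl sqr_ge0. Qed.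

Lemma grad_ge0 x : 0 <= grad_sqnorm u x.
Proof. by apply: sumr_ge0 => i _; apply: sumr_ge0 => j _; exact: sqr_ge0. Qed.

Lemma grad_cont : continuous (grad_sqnorm u).
Proof.
have cd i j : continuous (partial i (component u j)) by have [_] := cu j; exact.
have -> := funext (grad_sqnormE su).
have cs i j : continuous (fun x => partial i (component u j) x ^+ 2) := cont_exp (n := 2) (cd i j).
have cs3 i : continuous (fun x => partial i (component u 0) x ^+ 2
    + partial i (component u 1) x ^+ 2 + partial i (component u 2) x ^+ 2) :=
  cont_add (cont_add (cs i 0) (cs i 1)) (cs i 2).
exact: (cont_add (cont_add (cs3 0) (cs3 1)) (cs3 2)).
Qed.

Let cauchy (a b E : R) : a ^+ 2 + b ^+ 2 <= E -> (a + t * b) ^+ 2 <= c * E.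
Proof.
move=> abE; apply: (@le_trans _ _ (c * (a ^+ 2 + b ^+ 2))).
  by have := sqr_ge0 (b - t * a); rewrite /c; lra.
by rewrite ler_wpM2l// (le_trans ler01).
Qed.

Let lateral_le x : partial 2 (component u 0) x ^+ 2 + partial 2 (component u 1) x ^+ 2 <= grad_sqnorm u x.
Proof.
rewrite (grad_sqnormE su).
have h i k : 0 <= partial i (component u k) x ^+ 2 by exact: sqr_ge0.
move: (h 0 0) (h 0 1) (h 0 2) (h 1 0) (h 1 1) (h 1 2) (h 2 2).
by atoms => *; lra.
Qed.

Let vert_sqr_le x : partial 2 (component u 2) x ^+ 2 <= grad_sqnorm u x.
Proof. by apply: le_trans (grad_comp_le su 2 x); rewrite lerDr addr_ge0// sqr_ge0. Qed.

Lemma radial_sqr_le j x : radial t (component u j) x ^+ 2 <= c * grad_sqnorm u x.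
Proof.
apply: cauchy; apply: le_trans (grad_comp_le su j x).
by rewrite lerDl sqr_ge0.
Qed.

Let moment_sqr_le s z :
  partial 2 radial_moment (X s z) ^+ 2 <= c * s ^+ 2 * grad_sqnorm u (X s z).
Proof.
rewrite (partial_moment 2) /X ray_0 ray_1.
rewrite (_ : (2 == 0 :> 'I_3) = false)// (_ : (2 == 1 :> 'I_3) = false)//.
rewrite mulr0n !mul0r !add0r.
have := lateral_le (ray t s z); generalize (grad_sqnorm u (ray t s z))
  (partial 2 (component u 0) (ray t s z)) (partial 2 (component u 1) (ray t s z)) => E a b abE.
have -> : (s * a + s * t * b) ^+ 2 = s ^+ 2 * (a + t * b) ^+ 2 by ring.
have -> : c * s ^+ 2 * E = s ^+ 2 * (c * E) by ring.
by apply: ler_wpM2l; [exact: sqr_ge0|exact: cauchy].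
Qed.

(** The constants come from |u_j| <= 1 far away and 1 + t^2 <= 2. *)
Let far_bounds : exists s1, forall s z, s1 <= s ->
  [/\ component u 2 (X s z) ^+ 2 <= 1, kinetic u (X s z) ^+ 2 <= 4 &
      radial_moment (X s z) ^+ 2 <= 4 * s ^+ 2].
Proof.
have [M HM] := small_at_infinity (ltr01 : 0 < 1 :> R).
exists (Num.max 1 (M + 1)) => s z; rewrite ge_max => /andP[s1 sM].
have s0 : 0 <= s by lra.
have far : M < cyl_rad (X s z).
  apply: (@lt_le_trans _ _ s); first lra.
  rewrite /cyl_rad /x1 /x2 /X ray_0 ray_1 -[leLHS](ger0_norm s0) -sqrtr_sqr.
  by apply: ler_wsqrtr; rewrite lerDl sqr_ge0.
have U j : component u j (X s z) ^+ 2 <= 1.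
  have /ltW := HM _ far j; rewrite -/(component u j _) => h.
  by rewrite -[component _ _ _ ^+ 2]real_normK ?num_real// expr_le1.
have := U 0; have := U 1; have := U 2; rewrite /kinetic /radial_moment /X ray_0 ray_1.
generalize (component u 0 (ray t s z)) (component u 1 (ray t s z)) (component u 2 (ray t s z)).
move=> a b d d1 b1 a1.
have t0 := andP t01; case: t0 => t0 t1.
split=> //.
- have -> : 2^-1 * (a * a + b * b + d * d) = 2^-1 * (a ^+ 2 + b ^+ 2 + d ^+ 2) by ring.
  have a0 := sqr_ge0 a; have b0 := sqr_ge0 b; have d0 := sqr_ge0 d.
  have -> : 4 = 2 ^+ 2 :> R by ring.
  by rewrite ler_sqr ?nnegrE; lra.
- have -> : (s * a + s * t * b) ^+ 2 = s ^+ 2 * (a + t * b) ^+ 2 by ring.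
  rewrite mulrC; apply: ler_wpM2r; first exact: sqr_ge0.
  apply: (@le_trans _ _ (c * 2)); first by apply: cauchy; lra.
  have : t ^+ 2 <= 1 by rewrite expr_le1.
  by rewrite /c; lra.
Qed.

(** [ray_energy_eq0] for the restriction of u and p to the half-plane. *)
Lemma ray_gradient_eq0 :
  (exists D, forall S, 0 <= S ->
     rint 0 S (fun s => s * rint (- pi) pi (fun z => grad_sqnorm u (X s z))) <= D) ->
  forall s z, 0 < s -> - pi < z < pi -> grad_sqnorm u (X s z) = 0.
Proof.
move=> finite s z s0 zI.
have pp : - pi < pi :> R by have := pi_gt0 R; lra.
pose v s z := component u 2 (X s z).
pose vs s z := radial t (component u 2) (X s z).
pose vz s z := partial 2 (component u 2) (X s z).
pose w s z := radial_moment (X s z).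
have c2 := dcomp_c1 su 2 2.
have pc (f : R3 -> R) (cf : C1 f) : continuous (partial 2 f) := cf.2 2.
have cX (f : R3 -> R) (cf : continuous f) := @ray_cont R t f cf.
have cv : continuous (fun x : R * R => v x.1 x.2) := cX _ (c1_cont (cu 2)).
have cvs : continuous (fun x : R * R => vs x.1 x.2) := cX _ (@radial_cont R t _ (cu 2)).
have cvz : continuous (fun x : R * R => vz x.1 x.2) := cX _ (pc _ (cu 2)).
have dvs (s' z' : R) : is_derive s' 1 (v ^~ z') (vs s' z') := is_derive_ray t s' z' (cu 2).
have dvz (s' z' : R) : is_derive z' 1 (v s') (vz s' z') := is_derive_vert t s' z' (cu 2).
have dws (s' z' : R) : is_derive s' 1 (w ^~ z') (- c * s' * vz s' z').
  by rewrite -radial_moment_ray; exact: (is_derive_ray t s' z' moment_c1).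
have w0 z' : w 0 z' = 0.
  by rewrite /w /radial_moment /X ray_0 ray_1 !mul0r addr0.
have v_per s' : v s' (- pi) = v s' pi by rewrite /v /X ray_per /component u_per.
have f_per s' : axial_flux (X s' (- pi)) = axial_flux (X s' pi).
  by rewrite /X ray_per flux_per.
refine (@ray_energy_eq0 R (- pi) pi c v vs vz
  (fun s z => partial 2 (partial 2 (component u 2)) (X s z)) w
  (fun s z => partial 2 radial_moment (X s z))
  (fun s z => kinetic u (X s z)) (fun s z => radial t (kinetic u) (X s z))
  (fun s z => p (X s z)) (fun s z => partial 2 p (X s z))
  (fun s z => grad_sqnorm u (X s z))
  (fun s z => axial_flux (X s z)) (fun s z => partial 2 axial_flux (X s z))
  (stream (- pi) c v)
  pp c_ge1 cvs cvz (cX _ (pc _ c2)) (cX _ (c1_cont moment_c1)) (cX _ (pc _ moment_c1))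
  (cX _ (c1_cont ck)) (cX _ (@radial_cont R t _ ck)) (cX _ (c1_cont cp)) (cX _ (pc _ cp))
  (cX _ grad_cont) (cX _ (pc _ flux_c1)) (@stream_cont R (- pi) c v vs vz w cv cvs cvz dvs dvz dws w0) cv
  dvz (fun s z => is_derive_vert t s z c2) (fun s z => is_derive_vert t s z moment_c1)
  (fun s z => is_derive_ray t s z ck) (fun s z => is_derive_vert t s z cp)
  (fun s z => is_derive_vert t s z flux_c1) (stream_s (- pi) c cv cvs dvs)
  (@stream_z R (- pi) c v vz w cv cvz dvz dws w0) (stream_base (- pi) c v)
  (fun s => stream_periodic c s v_per) f_per w0 momentum_ray energy_ray
  (fun s z => grad_ge0 (X s z)) (fun s z => radial_sqr_le 2 (X s z))
  (fun s z => vert_sqr_le (X s z)) moment_sqr_le far_bounds finite s z s0 zI).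
Qed.

End OneRay.
End RayRigidity.

(** * Vanishing everywhere *)

Section Liouville.
Variables (R : realType) (u : 'rV[R]_3 -> 'rV[R]_3) (p : 'rV[R]_3 -> R).
Notation R3 := 'rV[R]_3.
Hypothesis su : smooth u.
Hypothesis sp : smooth p.
Hypothesis u_per : z_periodic u.
Hypothesis p_per : z_periodic p.
Hypothesis u_axi : axisymmetric_field u.
Hypothesis p_axi : axisymmetric_function p.
Hypothesis ns : navier_stokes u p.
Hypothesis u_infty : u x @[x --> @infty_nbhs R] --> (0 : R3).
Hypothesis u_dirichlet : (dirichlet_integral u < +oo)%E.

Let cu := comp_c1 su.

Lemma cyl_rad_ray (t s z : R) : 0 <= s -> cyl_rad (ray t s z) = s * Num.sqrt (1 + t ^+ 2).
Proof.
move=> s0; rewrite /cyl_rad /x1 /x2 ray_0 ray_1.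
have -> : s ^+ 2 + (s * t) ^+ 2 = s ^+ 2 * (1 + t ^+ 2) by ring.
by rewrite sqrtrM ?sqr_ge0// sqrtr_sqr ger0_norm.
Qed.

(** The gradient vanishes on the half-plane, so u is constant on each of its
    horizontal rays, and tends to 0 along them.  The two endpoints z = -pi and
    z = pi, where the vanishing of the gradient is not known, follow by
    continuity in z. *)
Let vanish_on_ray : exists t, forall s z, 0 < s -> - pi <= z <= pi ->
  u (ray t s z) = 0.
Proof.
have [t t01 finite] := finite_energy_ray (grad_cont su) (grad_ge0 u) u_dirichlet.
have E0 := ray_gradient_eq0 su sp u_per p_per u_axi p_axi ns u_infty t01 finite.
have inside s z j : 0 < s -> - pi < z < pi -> component u j (ray t s z) = 0.
  move=> s0 zI.
  have der (y : R) : 0 < y -> is_derive y 1 (fun s => component u j (ray t s z)) 0.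
    move=> y0; have := is_derive_ray t y z (cu j).
    have := radial_sqr_le su t j (ray t y z); rewrite (E0 y z y0 zI) mulr0 => h.
    have /eqP : radial t (component u j) (ray t y z) ^+ 2 = 0.
      by apply/eqP; rewrite eq_le h sqr_ge0.
    by rewrite sqrf_eq0 => /eqP ->.
  have const y : s <= y -> component u j (ray t y z) = component u j (ray t s z).
    move=> sy; apply/eqP; rewrite eq_le; apply/andP; split.
      rewrite -lerN2; apply: (@derive_ge0_le _ (fun s => - component u j (ray t s z)) (fun=> 0) s y sy) => //.
      move=> x /andP[sx _]; have := is_deriveN (der x (lt_le_trans s0 sx)).
      by rewrite oppr0.
    apply: (@derive_ge0_le _ (fun s => component u j (ray t s z)) (fun=> 0) s y sy) => //.
    by move=> x /andP[sx _]; exact: der (lt_le_trans s0 sx).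
  apply/eqP/negPn/negP => n0.
  have e0 : 0 < `|component u j (ray t s z)| by rewrite normr_gt0.
  have [M HM] := small_at_infinity u_infty e0.
  (* a point of the same ray beyond radius M *)
  pose y := s + `|M| + 1.
  have y0 : 0 <= y by rewrite !addr_ge0// ltW.
  have My : M < cyl_rad (ray t y z).
    rewrite cyl_rad_ray//; apply: (@lt_le_trans _ _ y).
      by rewrite /y; have := ler_norm M; lra.
    rewrite ler_peMr// -[leLHS]sqrtr1; apply: ler_wsqrtr.
    by rewrite lerDl sqr_ge0.
  have := HM _ My j; rewrite -/(component u j _) const ?ltxx//.
  by rewrite /y -addrA lerDl addr_ge0.
have cz s j : continuous (fun z => component u j (ray t s z)).
  by apply: cont_comp_vec3 (c1_cont (cu j)) _ _ _;
    [exact: cont_cst|exact: cont_cst|exact: cont_id].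
have pi1 : 1 < pi :> R by have := pi_ge2 R; lra.
exists t => s z s0 /andP[z1 z2]; apply/rowP => j; rewrite mxE -/(component u j _).
move: z1; rewrite le_eqVlt => /predU1P[<-|z1].
  have cf : continuous (fun x => component u j (ray t s (- pi + x))).
    move=> x; apply: (@continuous_comp _ _ _ (fun x => - pi + x) (fun z => component u j (ray t s z))).
      by apply: cvgD; [exact: cvg_cst|exact: cvg_id].
    exact: cz.
  have := continuous_eq0 cf; rewrite addr0; apply => x /andP[x0 x1].
  by apply: inside => //; apply/andP; split; lra.
move: z2; rewrite le_eqVlt => /predU1P[->|z2].
  have cf : continuous (fun x => component u j (ray t s (pi - x))).
    move=> x; apply: (@continuous_comp _ _ _ (fun x => pi - x) (fun z => component u j (ray t s z))).
      by apply: cvgB; [exact: cvg_cst|exact: cvg_id].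
    exact: cz.
  have := continuous_eq0 cf; rewrite subr0; apply => x /andP[x0 x1].
  by apply: inside => //; apply/andP; split; lra.
by apply: inside; rewrite ?z1.
Qed.

(** Each (r, z) in the strip is met by the chosen half-plane. *)
Let vanish_strip x : 0 < cyl_rad x -> - pi <= x 0 2 <= pi -> u x = 0.
Proof.
move=> r0 zI; have [t Ht] := vanish_on_ray.
have c0 : 0 < Num.sqrt (1 + t ^+ 2) by rewrite sqrtr_gt0 ltr_pwDl// sqr_ge0.
pose s := cyl_rad x / Num.sqrt (1 + t ^+ 2).
have s0 : 0 < s by rewrite divr_gt0.
have rE : cyl_rad (ray t s (x 0 2)) = cyl_rad x.
  by rewrite cyl_rad_ray ?ltW// divfK// gt_eqF.
apply: (axisym_zero u_axi rE); first by rewrite vec3_2.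
  by rewrite rE.
exact: Ht.
Qed.

Let period_nat n x : u (x + vec3 0 0 (2 * pi *+ n)) = u x.
Proof.
elim: n x => [|n IH] x.
  by congr u; apply/rowP; apply: forall_I3; rewrite !mxE ?addr0.
rewrite -[RHS]IH -[RHS]u_per; congr u.
apply/rowP; apply: forall_I3; rewrite !mxE/= ?addr0//.
by rewrite mulrSr; ring.
Qed.

(** Periodicity brings z into [-pi, pi], by the multiple k of the period. *)
Lemma liouville x : u x = 0.
Proof.
apply: (axis_closure cu) => {x} x r0.
have pi0 : 0 < pi :> R := pi_gt0 R.
pose k := Num.floor ((x 0 2 + pi) / (2 * pi)).
pose y := x - vec3 0 0 (2 * pi *~ k).
have yr : cyl_rad y = cyl_rad x.
  by rewrite /cyl_rad /x1 /x2 !mxE/= !subr0.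
have yz : - pi <= y 0 2 <= pi.
  have := floor_itv ((x 0 2 + pi) / (2 * pi)); rewrite -/k.
  rewrite ler_pdivlMr ?mulr_gt0// ltr_pdivrMr ?mulr_gt0// intrD => /andP[h1 h2].
  by rewrite !mxE/= -mulrzr; apply/andP; split; lra.
have uy : u y = 0 by apply: vanish_strip; rewrite ?yr.
suff -> : u x = u y by [].
have [n [kE|kE]] : exists n : nat, k = n%:Z \/ k = - n%:Z.
  exists `|k|%N; have [h|/ltW h] := leP 0 k.
    by left; rewrite gez0_abs.
  by right; rewrite lez0_abs ?opprK.
- rewrite -(period_nat n y); congr u; apply/rowP; apply: forall_I3.
  + by rewrite !mxE/= subr0 addr0.
  + by rewrite !mxE/= subr0 addr0.
  + by rewrite !mxE/= kE -pmulrn subrK.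
- rewrite -(period_nat n x); congr u; apply/rowP; apply: forall_I3.
  + by rewrite !mxE/= subr0 addr0.
  + by rewrite !mxE/= subr0 addr0.
  + by rewrite !mxE/= kE mulrNz opprK -pmulrn.
Qed.

End Liouville.

Theorem theorem1p3 (R : realType)
    (u : 'rV[R]_3 -> 'rV[R]_3) (p : 'rV[R]_3 -> R)
    (u_smooth : smooth u) (p_smooth : smooth p)
    (u_periodic : z_periodic u) (p_periodic : z_periodic p)
    (u_axisym : axisymmetric_field u) (p_axisym : axisymmetric_function p)
    (up_ns : navier_stokes u p)
    (u_infty : u x @[x --> @infty_nbhs R] --> (0 : 'rV[R]_3))
    (u_dirichlet : (dirichlet_integral u < +oo)%E) :
  forall x : 'rV[R]_3, u x = 0.
Proof.
exact: (liouville u_smooth p_smooth u_periodic p_periodic u_axisym p_axisym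
  up_ns u_infty u_dirichlet).
Qed.
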